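(* There exist $K>0$, $D<\infty$ and weighted graphs satisfying $\mathrm{CD}(K,D)$ which are non-Feller and non-complete.
   Context: A weighted graph $G=(V,E,w,m)$ is a connected, undirected, simple, locally finite graph $(V,E)$ with vertex weights $m:V\to(0,\infty)$ and symmetric edge weights $w:E\to(0,\infty)$, $w(x,y)=w(y,x)$ (with $w(x,y)=0$ if $x\not\sim y$). The Laplacian is $\Delta f(x)=\frac1{m(x)}\sum_{y\sim x}w(x,y)(f(y)-f(x))$ for $f:V\to\mathbb{R}$. Set $\Gamma(f,g)=\frac12(\Delta(fg)-f\Delta g-g\Delta f)$, $\Gamma(f)=\Gamma(f,f)$, and $\Gamma_2(f)=\frac12\Delta\Gamma(f)-\Gamma(f,\Delta f)$. For $K\in\mathbb{R}$, $D\in(0,\infty]$ (with $1/\infty=0$) and $x\in V$, the condition $\mathrm{CD}(K,D,x)$ means $\Gamma_2(f)(x)\ge\frac1D(\Delta f(x))^2+K\,\Gamma(f)(x)$ for all $f:V\to\mathbb{R}$; $\mathrm{CD}(K,D)$ means that $\mathrm{CD}(K,D,x)$ holds for all $x\in V$. $G$ is complete if there is a non-decreasing sequence of finitely supported functions $\{\eta_k\}_{k=1}^\infty$ on $V$ such that $\lim_{k\to\infty}\eta_k(x)=1$ and $\Gamma(\eta_k)(x)\le\frac1k$ for all $x\in V$ (and all $k$). $G$ is Feller if the minimal heat semigroup $e^{t\Delta}$ (associated with the Dirichlet Laplacian on $\ell^2(V,m)$ and extended to $\ell^\infty(V)$) maps $C_0(V)$ into $C_0(V)$ for all $t\geq 0$,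 where $C_0(V)$ is the closure of the finitely supported functions under the supremum norm. *)

(* Defs.v *)
From HB Require Import structures.
From mathcomp Require Import all_boot all_order all_algebra.
From mathcomp Require Import all_classical all_reals all_analysis.
Set Implicit Arguments.
Unset Strict Implicit.
Unset Printing Implicit Defensive.
Import Order.TTheory GRing.Theory Num.Theory.
Import numFieldNormedType.Exports.
Local Open Scope classical_set_scope.
Local Open Scope ring_scope.

Record weighted_graph (R : realType) (V : choiceType) := WeightedGraph {
  adj : rel V ;
  weight : V -> V -> R ;
  mass : V -> R ;
  adj_sym : symmetric adj ;
  adj_irrefl : irreflexive adj ;
  adj_locally_finite : forall x, finite_set [set y | adj x y] ;
  adj_connected : forall x y, exists2 p : seq V, path adj x p & last x p = y ;
  weight_sym : forall x y, weight x y = weight y x ;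
  weight_gt0 : forall x y, adj x y -> 0 < weight x y ;
  weight_eq0 : forall x y, ~~ adj x y -> weight x y = 0 ;
  mass_gt0 : forall x, 0 < mass x }.

Section Curvature.
Context {R : realType} {V : choiceType}.
Variable G : weighted_graph R V.
Implicit Types f g : V -> R.

Definition laplacian f : V -> R := fun x =>
  (mass G x)^-1 * \sum_(y \in [set y | adj G x y]) (weight G x y * (f y - f x)).

Definition Gamma f g : V -> R := fun x =>
  2^-1 * (laplacian (f \* g) x - f x * laplacian g x - g x * laplacian f x).

Definition Gamma2 f : V -> R := fun x =>
  2^-1 * laplacian (Gamma f f) x - Gamma f (laplacian f) x.

Definition CD_at (K D : R) (x : V) : Prop := forall f,
  D^-1 * (laplacian f x) ^+ 2 + K * Gamma f f x <= Gamma2 f x.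

Definition CD (K D : R) : Prop := forall x, CD_at K D x.

Definition finsupp f : Prop := finite_set [set x | f x != 0].

(* [eta k] is the (k+1)-st function of a sequence indexed from 1. *)
Definition complete_graph : Prop := exists eta : nat -> V -> R,
  [/\ forall k, finsupp (eta k),
      forall k x, eta k x <= eta k.+1 x,
      forall x, eta k x @[k --> \oo] --> (1 : R) &
      forall k x, Gamma (eta k) (eta k) x <= (k.+1%:R)^-1].

End Curvature.

Section HeatSemigroup.
Context {R : realType} {V : choiceType}.
Variable G : weighted_graph R V.
Implicit Types f g u : V -> R.

(* Squared norm of l^2(V, m), with value +oo outside l^2(V, m). *)
Definition l2norm2 f : \bar R :=
  (\esum_(x in [set: V]) (mass G x * f x ^+ 2)%:E)%E.

Definition l2 f : Prop := (l2norm2 f < +oo)%E.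

(* The factor 1/2 compensates for counting each edge in both directions. *)
Definition energy f : \bar R :=
  (\esum_(e in [set: V * V])
     (2^-1 * (weight G e.1 e.2 * (f e.1 - f e.2) ^+ 2))%:E)%E.

(* Domain of the Dirichlet form: closure of the finitely supported functions
   for the norm (|f|_2^2 + energy f)^(1/2). *)
Definition dirichlet_form_domain f : Prop :=
  l2 f /\ exists2 phi : nat -> V -> R, forall n, finsupp (phi n) &
    (l2norm2 (f \- phi n)%R + energy (f \- phi n)%R)%E @[n --> \oo] --> (0%E : \bar R).

(* Graph of the Dirichlet Laplacian, the operator on l^2(V, m) associated with
   the Dirichlet form. It acts as [laplacian] by Green's formula against
   indicators of vertices, which also identifies its domain. *)
Definition dirichlet_laplacian u g : Prop :=
  [/\ dirichlet_form_domain u, l2 g & g = laplacian G u].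

(* [P] is the strongly continuous semigroup of bounded operators on l^2(V, m)
   generated by the Dirichlet Laplacian; only the values [P t f] with [0 <= t]
   and [f] in l^2(V, m) are constrained, and these are determined uniquely. *)
Record is_heat_semigroup (P : R -> (V -> R) -> (V -> R)) : Prop := {
  heat_l2 : forall t f, 0 <= t -> l2 f -> l2 (P t f) ;
  heat_linear : forall t (a : R) f g, 0 <= t -> l2 f -> l2 g ->
    P t (fun x => a * f x + g x) = (fun x => a * P t f x + P t g x) ;
  heat_bounded : forall t, 0 <= t -> exists M : R, forall f, l2 f ->
    (l2norm2 (P t f) <= M%:E * l2norm2 f)%E ;
  heat_0 : forall f, l2 f -> P 0 f = f ;
  heat_add : forall s t f, 0 <= s -> 0 <= t -> l2 f ->
    P (s + t) f = P s (P t f) ;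
  heat_continuous : forall f, l2 f ->
    l2norm2 (P t f \- f) @[t --> 0^'+] --> (0%E : \bar R) ;
  heat_generator : forall u g, l2 u -> l2 g ->
    (l2norm2 (fun x => t^-1 * (P t u x - u x) - g x) @[t --> 0^'+]
       --> (0%E : \bar R))
    <-> dirichlet_laplacian u g }.

(* Monotone extension to bounded functions: first to nonnegative ones, by
   approximation from below, then to signed ones by linearity. *)
Definition heat_extension_nonneg (P : R -> (V -> R) -> (V -> R)) (t : R) f :
    V -> R := fun x =>
  sup [set P t g x | g in [set g | finsupp g /\ forall y, 0 <= g y <= f y]].

Definition heat_extension (P : R -> (V -> R) -> (V -> R)) (t : R) f :
    V -> R := fun x =>
  heat_extension_nonneg P t (fun y => Num.max (f y) 0) x -
  heat_extension_nonneg P t (fun y => Num.max (- f y) 0) x.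

Definition C0 f : Prop := forall e : R, 0 < e ->
  exists2 phi : V -> R, finsupp phi & forall x, `|f x - phi x| <= e.

(* A heat semigroup exists for every weighted graph and is unique in the above
   sense, so the quantifier over [P] ranges over one semigroup. *)
Definition feller : Prop := forall P, is_heat_semigroup P ->
  forall t f, 0 <= t -> C0 f -> C0 (heat_extension P t f).

End HeatSemigroup.

(* Main.v *)
Require Import Defs.
From mathcomp Require Import all_boot all_order all_algebra.
From mathcomp Require Import all_classical all_reals all_analysis.
From mathcomp Require Import ring lra.
Set Implicit Arguments.
Unset Strict Implicit.
Unset Printing Implicit Defensive.
Import Order.TTheory GRing.Theory Num.Theory.
Import numFieldNormedType.Exports.
Local Open Scope classical_set_scope.
Local Open Scope ring_scope.

(* The graph is the birth-death chain on nat with jump rates 4^n from n to n+1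
   and 2 (4^n - 1) from n to n-1.  In the coordinate xi = 4^-n its Laplacian maps
   xi^k to a combination of xi^(k-1) and xi^k, so it has polynomial
   eigenfunctions (little q-Laguerre polynomials, q = 1/4) with eigenvalues
   - 2 (4^k - 1).  They form an orthogonal basis of l^2(V, m), and since infinity
   is an entrance boundary the operator they diagonalise is exactly the Dirichlet
   Laplacian; the heat semigroup is thus explicit.  It sends xi, which lies in
   C_0, to an affine function of xi with positive value at xi = 0, so the graph is
   not Feller.  The rates grow fast enough for the intrinsic diameter to be
   finite, which excludes completeness, and Gamma_2 is an explicit quadratic form
   in four increments, which gives CD(1, 16). *)

(** * Series and weighted square-summable sequences *)

(** [feller] quantifies over all heat semigroups, so refuting it requires exhibiting one and proving
    every law for it, including the exact domain of its generator. The explicit basis replaces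
    general semigroup theory: each law reduces to a statement about the scalar factors exp(-t lam
    k). The delicate point is the domain. In one direction, membership in the form domain must kill
    the boundary term of Green's formula at infinity; in the other, a function whose coordinates
    obey the eigenvalue relation must be shown to lie in the form domain. Both rest on the factor 2
    in the downward rate: the masses decay roughly like 8^-n, so the edge weights, of order 2^-n,
    are summable, while the masses times 16^n still grow. The drift towards 0 created by this factor
    is also why the influence of the vertices near 0 does not fade at infinity. *)

Section Series.
Context {R : realType}.
Implicit Types u v : R^nat.

Lemma series_nneg_cvgP u (M : R) : (forall n, 0 <= u n) ->
  (forall n, series u n <= M) -> cvgn (series u) /\ limn (series u) <= M.
Proof.
move=> u0 uM; have cu : cvgn (series u).
  apply: nondecreasing_is_cvgn; first exact: nondecreasing_series.
  by exists M => _ [n _ <-].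
by split=> //; apply: limr_le => //; near=> n; exact: uM.
Unshelve. all: by end_near. Qed.

Lemma series_le_lim u n : (forall n, 0 <= u n) -> cvgn (series u) ->
  series u n <= limn (series u).
Proof. by move=> u0 cu; apply: nondecreasing_cvgn_le => //; exact: nondecreasing_series. Qed.

Lemma cvg_series_tail u : cvgn (series u) ->
  (limn (series u) - series u n) @[n --> \oo] --> (0 : R).
Proof.
move=> cu; rewrite -[X in _ --> X](subrr (limn (series u))).
by apply: cvgB; [exact: cvg_cst | exact: cu].
Qed.

(* Tannery's theorem along an arbitrary filter. *)
Lemma cvg_dominated_series {T : Type} (F : set_system T) {FF : Filter F}
    (a : T -> R^nat) (b : R^nat) :
  cvgn (series b) -> (\forall t \near F, forall n, 0 <= a t n <= b n) ->
  (forall n, a t n @[t --> F] --> (0 : R)) ->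
  limn (series (a t)) @[t --> F] --> (0 : R).
Proof.
move=> cb ab a0.
have sN (n : nat) : series (a t) n @[t --> F] --> (0 : R).
  elim: n => [|n IH].
    by rewrite (_ : (fun t => _) = fun=> 0); [exact: cvg_cst|];
      apply/funext => t; rewrite /series /= big_nil.
  rewrite (_ : (fun t => _) = (fun t => series (a t) n + a t n)).
    by rewrite -[X in _ --> X](addr0 0); apply: cvgD.
  by apply/funext => t; rewrite seriesSr.
apply/cvgrPdist_le => e e0.
have e2 : 0 < e / 2 by rewrite divr_gt0.
have [N _ HN] := (cvgrPdist_le _ _).1 (cvg_series_tail cb) _ e2.
have := HN N (leqnn N); rewrite sub0r normrN => tailN.
near=> t.
have abt : forall n, 0 <= a t n <= b n by near: t.
have b0 n : 0 <= b n by case/andP: (abt n) => /le_trans /[apply].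
have at0 n : 0 <= a t n by case/andP: (abt n).
(* This bound serves twice: it makes [series (a t)] converge, and it estimates the limit. *)
have key n : series (a t) n <= series (a t) N + (limn (series b) - series b N).
  case: (leqP n N) => nN.
    rewrite -[leLHS]addr0; apply: lerD.
      by apply: nondecreasing_series.
    by rewrite subr_ge0 series_le_lim.
  have h := series_le_lim n b0 cb.
  have h1 : series (a t) n - series (a t) N <= series b n - series b N.
    rewrite !sub_series_geq ?(ltnW nN)//.
    by apply: ler_sum => i _; case/andP: (abt i).
  lra.
have [ca la] := series_nneg_cvgP at0 key.
have la0 := series_le_lim 0 at0 ca.
rewrite sub0r normrN ger0_norm; last first.
  by apply: le_trans la0; rewrite /series /= big_nil.
have : `|0 - series (a t) N| <= e / 2.
  by near: t; exact: ((cvgrPdist_le _ _).1 (sN N) _ e2).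
rewrite sub0r normrN => /(le_trans (ler_norm _)).
have := ler_norm (limn (series b) - series b N); lra.
Unshelve. all: by end_near. Qed.

End Series.

Section WeightedL2.
Context {R : realType}.
Variable w : nat -> R.
Hypothesis w_gt0 : forall n, 0 < w n.
Implicit Types f g h : nat -> R.

Definition ipt f g : R^nat := fun n => w n * (f n * g n).
Definition ip f g : R := limn (series (ipt f g)).
Definition sqsum f : Prop := exists l : R, series (ipt f f) @ \oo --> l.

Lemma sqsumP f : sqsum f <-> cvgn (series (ipt f f)).
Proof. by split=> [?|?]; apply/cvg_ex. Qed.

Lemma ipt_ge0 f n : 0 <= ipt f f n.
Proof. by rewrite mulr_ge0 ?(ltW (w_gt0 _))// -expr2 sqr_ge0. Qed.

Lemma sqsum_bound f M : (forall n, series (ipt f f) n <= M) ->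
  sqsum f /\ ip f f <= M.
Proof. by rewrite sqsumP; exact/series_nneg_cvgP/ipt_ge0. Qed.

Lemma sqsum_dom f g (C : R) : (forall n, `|f n| <= C * `|g n|) -> sqsum g ->
  sqsum f.
Proof.
move=> fg /sqsumP cg; apply/sqsumP; apply: (@series_le_cvg _ (ipt f f) (C ^+ 2 *: ipt g g)).
- exact: ipt_ge0.
- by move=> n; rewrite mulr_ge0 ?sqr_ge0// ipt_ge0.
- move=> n; rewrite /ipt /= -[leRHS]/(C ^+ 2 * (w n * (g n * g n))).
  rewrite [leRHS]mulrCA ler_wpM2l ?(ltW (w_gt0 _))// -!expr2 -(real_normK (num_real (f n))).
  rewrite -(real_normK (num_real (g n))) -exprMn lerXn2r ?nnegrE ?normr_ge0//.
  exact: le_trans (fg n).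
- exact: is_cvg_seriesZ.
Qed.

Lemma sqsumD f g : sqsum f -> sqsum g -> sqsum (fun n => f n + g n).
Proof.
move=> /sqsumP cf /sqsumP cg; apply/sqsumP.
apply: (@series_le_cvg _ _ (2 *: ipt f f + 2 *: ipt g g)).
- exact: ipt_ge0.
- by move=> n; rewrite addr_ge0// mulr_ge0 ?ipt_ge0.
- move=> n; rewrite /ipt -[leRHS]/(2 * (w n * (f n * f n)) + 2 * (w n * (g n * g n))).
  have := ltW (w_gt0 n); have := sqr_ge0 (f n - g n); nra.
- by apply: is_cvg_seriesD; exact: is_cvg_seriesZ.
Qed.

Lemma sqsumZ (a : R) f : sqsum f -> sqsum (fun n => a * f n).
Proof. by move=> cf; apply: (sqsum_dom (C := `|a|) _ cf) => n; rewrite normrM. Qed.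

Lemma sqsumB f g : sqsum f -> sqsum g -> sqsum (fun n => f n - g n).
Proof.
move=> cf cg; rewrite (_ : (fun n => _) = fun n => f n + (-1) * g n).
  by apply: sqsumD => //; exact: sqsumZ.
by apply/funext => n; rewrite mulN1r.
Qed.

(** Polarization: a product is half of the square of the sum minus both squares. *)
Lemma ip_cvg f g : sqsum f -> sqsum g -> cvgn (series (ipt f g)).
Proof.
move=> cf cg.
rewrite (_ : ipt f g = 2^-1 *: (ipt (fun n => f n + g n) (fun n => f n + g n)
   - ipt f f - ipt g g)).
  have /sqsumP cfg := sqsumD cf cg; move/sqsumP in cf; move/sqsumP in cg.
  by apply: is_cvg_seriesZ; apply: is_cvg_seriesB => //; exact: is_cvg_seriesB.
apply/funext => n; rewrite /ipt.
rewrite -[RHS]/(2^-1 * (w n * ((f n + g n) * (f n + g n)) - w n * (f n * f n) - w n * (g n * g n))).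
by field.
Qed.

Lemma ip_cvgP f g : sqsum f -> sqsum g -> series (ipt f g) @ \oo --> ip f g.
Proof. exact: ip_cvg. Qed.

Lemma ipC f g : ip f g = ip g f.
Proof. by rewrite /ip; congr (limn (series _)); apply/funext => n; rewrite /ipt (mulrC (f n)). Qed.

Lemma ipDl f g h : sqsum f -> sqsum g -> sqsum h ->
  ip (fun n => f n + g n) h = ip f h + ip g h.
Proof.
move=> cf cg ch; rewrite /ip -lim_seriesD; [|exact: ip_cvg..].
by congr (limn (series _)); apply/funext => n; rewrite /ipt mulrDl mulrDr.
Qed.

Lemma ipZl (a : R) f h : sqsum f -> sqsum h ->
  ip (fun n => a * f n) h = a * ip f h.
Proof.
move=> cf ch; rewrite /ip -[RHS]/(a *: _) -lim_seriesZ; last exact: ip_cvg.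
congr (limn (series _)); apply/funext => n; rewrite /ipt -[RHS]/(a * _); ring.
Qed.

Lemma ipBl f g h : sqsum f -> sqsum g -> sqsum h ->
  ip (fun n => f n - g n) h = ip f h - ip g h.
Proof.
move=> cf cg ch; rewrite /ip -lim_seriesB; [|exact: ip_cvg..].
by congr (limn (series _)); apply/funext => n; rewrite /ipt mulrBl mulrBr.
Qed.

Lemma ip_partial f n : sqsum f -> series (ipt f f) n <= ip f f.
Proof. by move=> /sqsumP; exact/series_le_lim/ipt_ge0. Qed.

Lemma ip_ge0 f : sqsum f -> 0 <= ip f f.
Proof. by move/(ip_partial 0); apply: le_trans; rewrite /series /= big_nil. Qed.

Lemma ip_term f n : sqsum f -> w n * (f n) ^+ 2 <= ip f f.
Proof.
move/(ip_partial n.+1); apply: le_trans; rewrite seriesSr /ipt expr2 lerDr.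
by rewrite sumr_ge0// => i _; exact: ipt_ge0.
Qed.

Lemma ip_CS f g : sqsum f -> sqsum g -> (ip f g) ^+ 2 <= ip f f * ip g g.
Proof.
move=> cf cg.
have H (a : R) : 0 <= ip f f - 2 * a * ip f g + a ^+ 2 * ip g g.
  have cag := sqsumZ a cg; have cfg := sqsumB cf cag.
  have := ip_ge0 cfg; rewrite (ipBl cf cag cfg) (ipZl a cg cfg).
  rewrite (ipC f) (ipC g) (ipBl cf cag cf) (ipBl cf cag cg).
  rewrite (ipZl a cg cf) (ipZl a cg cg) (ipC g f); nra.
have g0 := ip_ge0 cg.
move: g0; rewrite le_eqVlt => /orP[/eqP g0|g0].
  have [->|fg0] := eqVneq (ip f g) 0; first by rewrite -g0 expr0n mulr0.
  (* When [ip g g] is 0 the quadratic [H] is affine in [a]; this value of [a] would make it -1. *)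
  have := H ((ip f f + 1) / (2 * ip f g)); rewrite -g0 mulr0 addr0.
  by rewrite (_ : 2 * _ * _ = ip f f + 1); [lra|field].
have := H (ip f g / ip g g).
rewrite (_ : _ + _ = (ip f f * ip g g - ip f g ^+ 2) / ip g g).
  by rewrite pmulr_lge0 ?invr_gt0// subr_ge0.
by field; rewrite gt_eqF.
Qed.

Definition cutoff (N : nat) f : nat -> R := fun n => if (n < N)%N then f n else 0.

Lemma series_finite f g N : (forall n, (N <= n)%N -> g n = 0) ->
  cvgn (series (ipt f g)) /\ ip f g = series (ipt f g) N.
Proof.
move=> g0; have E n : (N <= n)%N -> series (ipt f g) n = series (ipt f g) N.
  move=> Nn; apply/eqP; rewrite -subr_eq0 sub_series_geq// big_nat big1// => i /andP[Ni _].
  by rewrite /ipt g0// !mulr0.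
have : series (ipt f g) @ \oo --> series (ipt f g) N.
  apply: cvg_near_cst; exists N => // n /= Nn; exact/E.
by move=> c; split; [apply/cvg_ex; eexists; exact: c | exact/cvg_lim].
Qed.

Lemma sqsum_finite f N : (forall n, (N <= n)%N -> f n = 0) -> sqsum f.
Proof. by move=> f0; apply/sqsumP; case: (series_finite f f0). Qed.

Lemma sqsum_cutoff N f : sqsum (cutoff N f).
Proof. by apply: (@sqsum_finite _ N) => n Nn; rewrite /cutoff ltnNge Nn. Qed.

Lemma cvg_cutoff f : sqsum f ->
  ip (fun n => f n - cutoff N f n) (fun n => f n - cutoff N f n) @[N --> \oo]
    --> (0 : R).
Proof.
move=> /sqsumP cf; apply: (@cvg_dominated_series _ _ _ _ _ (ipt f f) cf).
  near=> N => n; rewrite ipt_ge0//= /ipt /cutoff; case: ifP => _; last by rewrite subr0.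
  by rewrite subrr !mulr0; exact: ipt_ge0.
move=> n; apply: cvg_near_cst; near=> N; rewrite /ipt /cutoff.
have nN : (n < N)%N by near: N; exact: nbhs_infty_gt.
by rewrite nN subrr !mulr0.
Unshelve. all: by end_near. Qed.

End WeightedL2.

(** * Semigroups diagonalised by an orthogonal basis *)

(* [p k] is orthogonal with [|p k|^2 = (nu k)^-1]; carrying [nu] as a weight on the
   coefficient side replaces the normalisation by square roots. *)
Section OrthogonalBasis.
Context {R : realType}.
Variables (m nu : nat -> R) (p : nat -> nat -> R).
Hypothesis m_gt0 : forall x, 0 < m x.
Hypothesis nu_gt0 : forall k, 0 < nu k.
Hypothesis p_sqsum : forall k, sqsum m (p k).
Hypothesis p_orth : forall k l, ip m (p k) (p l) = if k == l then (nu k)^-1 else 0.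
Implicit Types f g c d : nat -> R.

Definition coord f k : R := ip m (p k) f.
Definition synth_part c N x : R := series (ipt nu c (p^~ x)) N.
Definition synth c x : R := ip nu c (p^~ x).

Lemma synth_part0 c : synth_part c 0 = fun=> 0.
Proof. by apply/funext => x; rewrite /synth_part /series /= big_nil. Qed.

Lemma synth_partS c N :
  synth_part c N.+1 = fun x => synth_part c N x + nu N * c N * p N x.
Proof. by apply/funext => x; rewrite /synth_part seriesSr /ipt mulrA. Qed.

Lemma sqsum_synth_part c N : sqsum m (synth_part c N).
Proof.
elim: N => [|N IH]; first by rewrite synth_part0; exact: (@sqsum_finite _ _ _ 0).
by rewrite synth_partS; apply: sqsumD => //; exact: sqsumZ.
Qed.

Lemma ip_synth_part c N f : sqsum m f ->
  ip m (synth_part c N) f = series (ipt nu c (coord f)) N.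
Proof.
move=> cf; elim: N => [|N IH].
  rewrite synth_part0 ipC (proj2 (@series_finite _ _ _ _ 0 _))//.
  by rewrite /series /= !big_nil.
rewrite synth_partS (ipDl m_gt0 (sqsum_synth_part c N) (sqsumZ m_gt0 _ (p_sqsum N)) cf).
by rewrite IH (ipZl m_gt0 _ (p_sqsum N) cf) seriesSr /ipt mulrA.
Qed.

Lemma coord_synth_part c N l : coord (synth_part c N) l = cutoff N c l.
Proof.
rewrite /coord ipC (ip_synth_part _ _ (p_sqsum l)) /cutoff.
elim: N => [|N IH]; first by rewrite /series /= big_nil.
rewrite seriesSr IH /ipt /coord p_orth ltnS; case: (ltngtP l N) => [lN|lN|->].
- by rewrite !mulr0 addr0.
- by rewrite !mulr0 addr0.
- by rewrite add0r mulrCA divff ?mulr1// gt_eqF.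
Qed.

Lemma norm_synth_part c N :
  ip m (synth_part c N) (synth_part c N) = series (ipt nu c c) N.
Proof.
rewrite (ip_synth_part _ _ (sqsum_synth_part c N)) /series /=.
by apply: eq_big_nat => k /andP[_ kN]; rewrite /ipt coord_synth_part /cutoff kN.
Qed.

Lemma bessel f : sqsum m f ->
  sqsum nu (coord f) /\ ip nu (coord f) (coord f) <= ip m f f.
Proof.
move=> cf; apply: (sqsum_bound nu_gt0) => N.
have cs := sqsum_synth_part (coord f) N; have cfs := sqsumB m_gt0 cf cs.
have := ip_ge0 m_gt0 cfs; rewrite (ipBl m_gt0 cf cs cfs) (ipC _ f) (ipC _ (synth_part _ _)).
rewrite (ipBl m_gt0 cf cs cf) (ipBl m_gt0 cf cs cs) (ipC _ f) norm_synth_part ip_synth_part//.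
lra.
Qed.

Lemma coordZD (a : R) f g k : sqsum m f -> sqsum m g ->
  coord (fun x => a * f x + g x) k = a * coord f k + coord g k.
Proof.
move=> cf cg; rewrite /coord ipC (ipDl m_gt0 (sqsumZ m_gt0 _ cf) cg (p_sqsum k)).
by rewrite (ipZl m_gt0 _ cf (p_sqsum k)) !(ipC _ (p k)).
Qed.

Lemma coordB f g k : sqsum m f -> sqsum m g ->
  coord (fun x => f x - g x) k = coord f k - coord g k.
Proof. by move=> cf cg; rewrite /coord ipC (ipBl m_gt0 cf cg (p_sqsum k)) !(ipC _ (p k)). Qed.

(** Bessel's inequality for the indicator of [x], whose k-th coordinate is [m x * p k x]. It makes
    [synth] converge at every point. *)
Lemma sqsum_column x : sqsum nu (p^~ x).
Proof.
pose d y : R := if y == x then 1 else 0.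
have d0 n : (x < n)%N -> d n = 0 by rewrite /d; case: ltngtP.
have [cd _] := bessel (sqsum_finite m d0).
apply: (sqsum_dom (C := (m x)^-1) nu_gt0 _ cd) => k.
rewrite /coord (proj2 (series_finite _ _ d0)) seriesSr {2}/ipt /d eqxx mulr1.
rewrite /series /= big_nat big1 ?add0r; last first.
  by move=> i /andP[_ ix]; rewrite /ipt /d ltn_eqF// !mulr0.
by rewrite normrM gtr0_norm// mulKf// gt_eqF.
Qed.

Lemma synth_part_cvg c x : sqsum nu c -> synth_part c N x @[N --> \oo] --> synth c x.
Proof. by move=> cc; apply: ip_cvgP => //; exact: sqsum_column. Qed.

(** A Fatou argument: on the first [X] points [synth c] is the pointwise limit of finite syntheses,
    whose norms are bounded by that of [c]. *)
Lemma sqsum_synth c : sqsum nu c ->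
  sqsum m (synth c) /\ ip m (synth c) (synth c) <= ip nu c c.
Proof.
move=> cc; apply: (sqsum_bound m_gt0) => X.
have : series (ipt m (synth_part c N) (synth_part c N)) X @[N --> \oo]
    --> series (ipt m (synth c) (synth c)) X.
  elim: X => [|X IH].
    by under eq_fun do rewrite /series /= big_nil; rewrite /series /= big_nil; exact: cvg_cst.
  under eq_fun do rewrite seriesSr; rewrite seriesSr; apply: cvgD => //.
  by apply: cvgMr; apply: cvgM; exact: synth_part_cvg.
move=> h; rewrite -(cvg_lim _ h)//; apply: limr_le; first by apply/cvg_ex; eexists; exact: h.
near=> N; apply: (le_trans (ip_partial m_gt0 _ (sqsum_synth_part c N))).
by rewrite norm_synth_part ip_partial.
Unshelve. all: by end_near. Qed.

Lemma synthZD (a : R) c d x : sqsum nu c -> sqsum nu d ->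
  synth (fun k => a * c k + d k) x = a * synth c x + synth d x.
Proof.
move=> cc cd; have cx := sqsum_column x.
by rewrite /synth (ipDl nu_gt0 (sqsumZ nu_gt0 _ cc) cd cx) (ipZl nu_gt0 _ cc cx).
Qed.

Lemma synthB c d x : sqsum nu c -> sqsum nu d ->
  synth (fun k => c k - d k) x = synth c x - synth d x.
Proof. by move=> cc cd; rewrite /synth (ipBl nu_gt0 cc cd (sqsum_column x)). Qed.

Lemma synth_cutoff c N : synth (cutoff N c) = synth_part c N.
Proof.
apply/funext => x; rewrite /synth ipC (proj2 (@series_finite _ _ _ _ N _)).
  rewrite /synth_part /series /=; apply: eq_big_nat => k /andP[_ kN].
  by rewrite /ipt /cutoff kN (mulrC (p k x)).
by move=> n Nn; rewrite /cutoff ltnNge Nn.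
Qed.

(** Once [l < N] the error is the l-th coordinate of the synthesis of the tail of [c];
    Cauchy-Schwarz bounds its square by a multiple of the squared norm of that tail. *)
Lemma coord_synth c l : sqsum nu c -> coord (synth c) l = c l.
Proof.
move=> cc; apply/eqP; rewrite -subr_eq0 -sqrf_eq0; apply/eqP/le_anti.
rewrite sqr_ge0 andbT.
have h : ip m (p l) (p l) * ip nu (fun n => c n - cutoff N c n) (fun n => c n - cutoff N c n)
    @[N --> \oo] --> ip m (p l) (p l) * 0 by apply: cvgMr; exact: cvg_cutoff.
rewrite mulr0 in h; rewrite -(cvg_lim _ h)//.
apply: limr_ge; first by apply/cvg_ex; eexists; exact: h.
near=> N.
have lN : (l < N)%N by near: N; exact: nbhs_infty_gt.
have cN := sqsum_cutoff nu N c.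
have cd := sqsumB nu_gt0 cc cN.
have [cs les] := sqsum_synth cd.
have E : coord (synth c) l - c l = ip m (p l) (synth (fun n => c n - cutoff N c n)).
  rewrite (_ : c l = coord (synth_part c N) l); last by rewrite coord_synth_part /cutoff lN.
  rewrite -coordB; [|exact: proj1 (sqsum_synth cc)|exact: sqsum_synth_part].
  rewrite /coord; congr (ip _ _ _); apply/funext => x.
  by rewrite synthB// synth_cutoff.
rewrite E; apply: le_trans (ip_CS m_gt0 (p_sqsum l) cs) _.
by rewrite ler_wpM2l// ip_ge0.
Unshelve. all: by end_near. Qed.

Hypothesis p_total : forall f, sqsum m f -> (forall k, coord f k = 0) -> forall x, f x = 0.

Lemma synth_coord f : sqsum m f -> synth (coord f) = f.
Proof.
move=> cf; have [cc _] := bessel cf; have [cs _] := sqsum_synth cc.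
apply/funext => x; apply/esym/eqP; rewrite -subr_eq0; apply/eqP.
apply: (p_total (f := fun x => f x - synth (coord f) x)) => [|k]; first exact: sqsumB.
by rewrite coordB// coord_synth// subrr.
Qed.

Lemma parseval f : sqsum m f -> ip m f f = ip nu (coord f) (coord f).
Proof.
move=> cf; apply/eqP; rewrite eq_le (proj2 (bessel cf)) andbT.
by have := proj2 (sqsum_synth (proj1 (bessel cf))); rewrite synth_coord.
Qed.

Variable lam : nat -> R.
Hypothesis lam_ge0 : forall k, 0 <= lam k.

Definition heat t f : nat -> R := synth (fun k => expR (- (t * lam k)) * coord f k).

Lemma expRNlam_le1 t k : 0 <= t -> expR (- (t * lam k)) <= 1.
Proof. by move=> t0; rewrite -expR0 ler_expR oppr_le0 mulr_ge0. Qed.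

Lemma sqsum_damped t f : 0 <= t -> sqsum m f ->
  sqsum nu (fun k => expR (- (t * lam k)) * coord f k).
Proof.
move=> t0 cf; apply: (sqsum_dom (C := 1) nu_gt0 _ (proj1 (bessel cf))) => k.
by rewrite normrM gtr0_norm ?expR_gt0// ler_wpM2r// expRNlam_le1.
Qed.

Lemma sqsum_heat t f : 0 <= t -> sqsum m f -> sqsum m (heat t f).
Proof. by move=> t0 cf; apply: proj1 (sqsum_synth (sqsum_damped t0 cf)). Qed.

Lemma coord_heat t f k : 0 <= t -> sqsum m f ->
  coord (heat t f) k = expR (- (t * lam k)) * coord f k.
Proof. by move=> t0 cf; rewrite coord_synth//; exact: sqsum_damped. Qed.

Lemma heatZD t (a : R) f g : 0 <= t -> sqsum m f -> sqsum m g ->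
  heat t (fun x => a * f x + g x) = fun x => a * heat t f x + heat t g x.
Proof.
move=> t0 cf cg; apply/funext => x; rewrite /heat -synthZD; [|exact: sqsum_damped..].
by congr (ip _ _ _); apply/funext => k; rewrite coordZD//; ring.
Qed.

Lemma heat_contraction t f : 0 <= t -> sqsum m f ->
  ip m (heat t f) (heat t f) <= ip m f f.
Proof.
move=> t0 cf; rewrite !parseval//; last exact: sqsum_heat.
apply: lim_series_le.
- by apply: ip_cvg => //; apply: (proj1 (bessel _)) => //; exact: sqsum_heat.
- by apply: ip_cvg => //; apply: (proj1 (bessel _)).
move=> k; rewrite /ipt coord_heat// ler_wpM2l ?(ltW (nu_gt0 _))//.
rewrite mulrACA -[leRHS]mul1r ler_wpM2r -?expr2 ?sqr_ge0//.
by rewrite expr_le1 ?expR_ge0 ?expRNlam_le1.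
Qed.

Lemma heat0 f : sqsum m f -> heat 0 f = f.
Proof.
move=> cf; rewrite -[RHS]synth_coord//; congr synth; apply/funext => k.
by rewrite mul0r oppr0 expR0 mul1r.
Qed.

Lemma heatD s t f : 0 <= s -> 0 <= t -> sqsum m f ->
  heat (s + t) f = heat s (heat t f).
Proof.
move=> s0 t0 cf; congr synth; apply/funext => k.
by rewrite coord_heat// mulrA -expRD -opprD -mulrDl.
Qed.

Lemma heat_coord_eq t f g : 0 <= t -> sqsum m f -> sqsum m g ->
  (forall k, coord g k = expR (- (t * lam k)) * coord f k) -> heat t f = g.
Proof.
move=> t0 cf cg H; rewrite -(synth_coord cg); congr synth; exact/esym/funext.
Qed.

Lemma cvg_expRN_right k : expR (- (t * lam k)) @[t --> (0 : R)^'+] --> (1 : R).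
Proof.
rewrite -[X in _ --> X]expR0; apply: continuous_cvg; first exact: continuous_expR.
rewrite -[X in _ --> X]oppr0; apply: cvgN; rewrite -[X in _ --> X](mul0r (lam k)).
by apply: cvgMl; apply: cvg_at_right_filter; exact: cvg_id.
Qed.

(** By Parseval this is a series in k with terms tending to 0, dominated by the squared coordinates
    of [f] because the factors [expR _ - 1] lie in [-1, 0]. *)
Lemma heat_right_continuous f : sqsum m f ->
  ip m (fun x => heat t f x - f x) (fun x => heat t f x - f x) @[t --> 0^'+] --> (0 : R).
Proof.
move=> cf.
pose a t := ipt nu (fun k => (expR (- (t * lam k)) - 1) * coord f k)
   (fun k => (expR (- (t * lam k)) - 1) * coord f k).
have : limn (series (a t)) @[t --> 0^'+] --> (0 : R).
  apply: (cvg_dominated_series (b := ipt nu (coord f) (coord f))).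
  - apply/sqsumP; exact: (proj1 (bessel cf)).
  - near=> t => k; rewrite /a ipt_ge0//= /ipt ler_wpM2l ?(ltW (nu_gt0 _))//.
    rewrite mulrACA -[leRHS]mul1r ler_wpM2r -?expr2 ?sqr_ge0//.
    have t0 : 0 <= t by apply: ltW; near: t; exact: nbhs_right_gt.
    have := expRNlam_le1 k t0; have := expR_gt0 (- (t * lam k)); nra.
  - move=> k; rewrite /a /ipt.
    have h : (expR (- (t * lam k)) - 1) * coord f k @[t --> 0^'+] --> (1 - 1) * coord f k.
      by apply: cvgMl; apply: cvgB; [exact: cvg_expRN_right|exact: cvg_cst].
    rewrite subrr mul0r in h.
    by rewrite -[X in _ --> X](mulr0 (nu k)) -[X in _ * X](mulr0 0); apply: cvgMr; apply: cvgM.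
apply: cvg_trans; apply: near_eq_cvg; near=> t.
have t0 : 0 <= t by apply: ltW; near: t; exact: nbhs_right_gt.
rewrite parseval; last by apply: sqsumB => //; exact: sqsum_heat.
rewrite /ip (_ : coord _ = fun k => (expR (- (t * lam k)) - 1) * coord f k)//.
apply/funext => k; rewrite coordB//; last exact: sqsum_heat.
by rewrite coord_heat// mulrBl mul1r.
Unshelve. all: by end_near. Qed.

(* Elementary, from [1 + y <= exp y] at both [y] and [-y]. *)
Lemma expRN_diffquot t k : 0 < t ->
  [/\ t^-1 * (expR (- (t * lam k)) - 1) <= 0,
      - lam k <= t^-1 * (expR (- (t * lam k)) - 1) &
      t^-1 * (expR (- (t * lam k)) - 1) <= - lam k + t * lam k ^+ 2].
Proof.
move=> t0; have l0 := lam_ge0 k.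
have h1 := expRNlam_le1 k (ltW t0).
have h2 := expR_ge1Dx (- (t * lam k)).
have h3 := expR_ge1Dx (t * lam k).
have h4 : expR (t * lam k) * expR (- (t * lam k)) = 1 by rewrite -expRD subrr expR0.
have e0 := expR_gt0 (- (t * lam k)).
split; rewrite mulrC.
- by rewrite pmulr_lle0 ?invr_gt0// subr_le0.
- rewrite ler_pdivlMr//; lra.
- rewrite ler_pdivrMr//; nra.
Qed.

Lemma cvg_expRN_diffquot k :
  t^-1 * (expR (- (t * lam k)) - 1) @[t --> (0 : R)^'+] --> - lam k.
Proof.
apply: (@squeeze_cvgr _ _ _ _ (fun=> - lam k) (fun t => - lam k + t * lam k ^+ 2)).
- near=> t; have t0 : 0 < t by near: t; exact: nbhs_right_gt.
  by have [_ -> ->] := expRN_diffquot k t0.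
- exact: cvg_cst.
- rewrite -[X in _ --> X]addr0; apply: cvgD; first exact: cvg_cst.
  rewrite -[X in _ --> X](mul0r (lam k ^+ 2)); apply: cvgMl.
  by apply: cvg_at_right_filter; exact: cvg_id.
Unshelve. all: by end_near. Qed.

(** Forward, each coordinate is controlled by the norm. Backward, the k-th coordinate of the error
    is [coord u k] times a number between 0 and [lam k], so it is dominated by [coord g k] and the
    limit can be taken term by term. *)
Lemma heat_generatorP u g : sqsum m u -> sqsum m g ->
  ip m (fun x => t^-1 * (heat t u x - u x) - g x)
       (fun x => t^-1 * (heat t u x - u x) - g x) @[t --> 0^'+] --> (0 : R)
  <-> forall k, coord g k = - lam k * coord u k.
Proof.
move=> cu cg.
pose q t k := t^-1 * (expR (- (t * lam k)) - 1) * coord u k - coord g k.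
have cq t : 0 < t -> sqsum m (fun x => t^-1 * (heat t u x - u x) - g x).
  move=> t0; apply: sqsumB => //; apply: sqsumZ => //; apply: sqsumB => //.
  exact/sqsum_heat/cu/ltW.
have coq t k : 0 < t -> coord (fun x => t^-1 * (heat t u x - u x) - g x) k = q t k.
  move=> t0; have ch := sqsum_heat (ltW t0) cu; have chu := sqsumB m_gt0 ch cu.
  rewrite coordB//; last exact: sqsumZ.
  rewrite /coord ipC (ipZl m_gt0 _ chu (p_sqsum k)) ipC -/(coord _ _) coordB//.
  by rewrite coord_heat ?(ltW t0)// /q /coord; ring.
have qlim k : q t k @[t --> 0^'+] --> - lam k * coord u k - coord g k.
  by apply: cvgB; [apply: cvgMl; exact: cvg_expRN_diffquot|exact: cvg_cst].
split=> [h k|E].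
  apply/esym/eqP; rewrite -subr_eq0 -sqrf_eq0.
  have q2 : nu k * (q t k * q t k) @[t --> 0^'+] --> (0 : R).
    apply: (squeeze_cvgr _ (cvg_cst (0 : R)) h).
    near=> t; have t0 : 0 < t by near: t; exact: nbhs_right_gt.
    rewrite mulr_ge0 ?(ltW (nu_gt0 _)) -?expr2 ?sqr_ge0//= -coq// parseval; last exact: cq.
    by apply: ip_term => //; apply: (proj1 (bessel _)); exact: cq.
  have q3 : nu k * (q t k * q t k) @[t --> 0^'+] -->
     nu k * ((- lam k * coord u k - coord g k) * (- lam k * coord u k - coord g k)).
    by apply: cvgMr; apply: cvgM.
  have : nu k * ((- lam k * coord u k - coord g k) * (- lam k * coord u k - coord g k)) = 0.
    by rewrite -(cvg_lim _ q3)//; exact: cvg_lim q2.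
  by move/eqP; rewrite mulf_eq0 gt_eqF//= -expr2.
have : limn (series (ipt nu (q t) (q t))) @[t --> 0^'+] --> (0 : R).
  apply: (cvg_dominated_series (b := ipt nu (coord g) (coord g))).
  - apply/sqsumP; exact: (proj1 (bessel cg)).
  - near=> t => k; rewrite ipt_ge0//= /ipt ler_wpM2l ?(ltW (nu_gt0 _))//.
    have t0 : 0 < t by near: t; exact: nbhs_right_gt.
    have [h1 h2 _] := expRN_diffquot k t0.
    rewrite /q E -!expr2 mulNr opprK -mulrDl sqrrN !exprMn ler_wpM2r ?sqr_ge0//.
    by have := lam_ge0 k; nra.
  - move=> k; have h := qlim k; rewrite E subrr in h.
    by rewrite -[X in _ --> X](mulr0 (nu k)) -[X in _ * X](mulr0 0); apply: cvgMr; apply: cvgM.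
apply: cvg_trans; apply: near_eq_cvg; near=> t.
have t0 : 0 < t by near: t; exact: nbhs_right_gt.
rewrite parseval; last exact: cq.
by rewrite /ip (_ : coord _ = q t)//; apply/funext => k; exact: coq.
Unshelve. all: by end_near. Qed.

End OrthogonalBasis.

(** * Extended-real sums over nat as limits of real series *)

Section ExtendedSums.
Context {R : realType}.
Implicit Types a : R^nat.

Lemma esum_nat_lim a : (forall n, 0 <= a n) -> cvgn (series a) ->
  (\esum_(x in [set: nat]) (a x)%:E = (limn (series a))%:E)%E.
Proof.
move=> a0 ca; rewrite -nneseries_esumT; last by move=> n; rewrite lee_fin.
rewrite -EFin_lim//; congr (limn _); apply/funext => n.
by rewrite /= /series /= -sumEFin.
Qed.

Lemma esum_nat_cvg a : (forall n, 0 <= a n) ->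
  (\esum_(x in [set: nat]) (a x)%:E < +oo)%E -> cvgn (series a).
Proof.
move=> a0; rewrite -nneseries_esumT; last by move=> n; rewrite lee_fin.
exact: nnseries_is_cvg.
Qed.

Lemma cvg0_EFin {T : Type} (F : set_system T) {FF : Filter F} (x : T -> R) :
  x t @[t --> F] --> (0 : R) <-> (x t)%:E @[t --> F] --> 0%E.
Proof.
split=> [h|/fine_cvgP[_ //]].
by apply: cvg_EFin => //; near=> t.
Unshelve. all: by end_near. Qed.

End ExtendedSums.

Lemma finite_set_nat_bound (A : set nat) : finite_set A ->
  exists M, forall n, A n -> (n < M)%N.
Proof.
move=> /finite_seqP[s ->]; exists (\max_(i <- s) i).+1 => n /= ns.
by rewrite ltnS; exact: leq_bigmax_seq.
Qed.

(** * The chain: curvature and incompleteness *)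

Section Chain.
Context {R : realType}.
Implicit Types (f g u : nat -> R) (n k i N : nat).

Definition up n : R := 4 ^+ n.
Definition down n : R := 2 * (4 ^+ n - 1).

(** The reversing measure: detailed balance across each edge forces these ratios. *)
Fixpoint chain_mass n : R :=
  if n is n'.+1 then chain_mass n' * (up n' / down n'.+1) else 1.

Definition edge n : R := chain_mass n * up n.

Definition chain_weight i j : R :=
  if j == i.+1 then edge i else if i == j.+1 then edge j else 0.

Definition chain_adj : rel nat := fun i j => (j == i.+1) || (i == j.+1).

Lemma up_gt0 n : 0 < up n. Proof. exact: exprn_gt0. Qed.

Lemma upS n : up n.+1 = 4 * up n. Proof. exact: exprS. Qed.

Lemma up_ge1 n : 1 <= up n.
Proof. by elim: n => [|n IH]; rewrite ?upS /up ?expr0//; rewrite /up in IH *; lra. Qed.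

Lemma downE n : down n = 2 * (up n - 1). Proof. by []. Qed.

Lemma down0 : down 0 = 0. Proof. by rewrite /down expr0 subrr mulr0. Qed.

Lemma downS_gt0 n : 0 < down n.+1.
Proof. by rewrite downE upS; have := up_ge1 n; lra. Qed.

Lemma chain_mass_gt0 n : 0 < chain_mass n.
Proof. by elim: n => //= n IH; rewrite mulr_gt0// divr_gt0 ?up_gt0 ?downS_gt0. Qed.

Arguments chain_mass : simpl never.

Lemma chain_massS n : chain_mass n.+1 = chain_mass n * (up n / down n.+1).
Proof. by []. Qed.

Lemma edge_gt0 n : 0 < edge n.
Proof. by rewrite mulr_gt0 ?chain_mass_gt0 ?up_gt0. Qed.

Lemma detailed_balance n : chain_mass n.+1 * down n.+1 = edge n.
Proof. by rewrite chain_massS /edge mulrA divfK// gt_eqF ?downS_gt0. Qed.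

Lemma chain_adj_sym : symmetric chain_adj.
Proof. by move=> i j; rewrite /chain_adj orbC. Qed.

Lemma chain_adj_irrefl : irreflexive chain_adj.
Proof. by move=> i; rewrite /chain_adj orbb; apply/negbTE; rewrite neq_ltn ltnSn. Qed.

Lemma chain_adj_0 : [set y | chain_adj 0 y] = [set` [:: 1%N]].
Proof.
by apply/seteqP; split=> y /=; rewrite /chain_adj inE ?orbF//= => /orP[]// /eqP.
Qed.

Lemma chain_adj_S n : [set y | chain_adj n.+1 y] = [set` [:: n; n.+2]].
Proof.
apply/seteqP; split=> y /=; rewrite /chain_adj !inE.
  by case/orP=> [->|]; rewrite ?orbT// eqSS eq_sym => ->.
by rewrite eqSS (eq_sym n y) orbC.
Qed.

Lemma chain_adj_finite i : finite_set [set y | chain_adj i y].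
Proof. by case: i => [|n]; rewrite ?chain_adj_0 ?chain_adj_S; exact: finite_seq. Qed.

Lemma chain_adj_connected i j :
  exists2 s : seq nat, path chain_adj i s & last i s = j.
Proof.
have up_path a b : exists2 s : seq nat, path chain_adj a s & last a s = (a + b)%N.
  elim: b a => [|b IH] a; first by exists [::]; rewrite ?addn0.
  have [s ps ls] := IH a.+1; exists (a.+1 :: s); last by rewrite /= ls addSnnS.
  by rewrite /= ps /chain_adj eqxx.
have down_path a b : exists2 s : seq nat, path chain_adj (a + b)%N s & last (a + b)%N s = a.
  elim: b a => [|b IH] a; first by exists [::]; rewrite ?addn0.
  have [s ps ls] := IH a; exists ((a + b)%N :: s); last by [].
  by rewrite [path _ _ _]/= ps andbT /chain_adj addnS eqxx orbT.
case: (leqP i j) => ij.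
  by have := up_path i (j - i)%N; rewrite subnKC.
by have := down_path j (i - j)%N; rewrite subnKC// ltnW.
Qed.

Lemma chain_weight_sym i j : chain_weight i j = chain_weight j i.
Proof.
rewrite /chain_weight; case: (eqVneq j i.+1) => [->|_]; last by case: eqP.
by case: eqP => // E; move: (leqnn i); rewrite {1}E ltnNge leqnSn.
Qed.

Lemma chain_weight_gt0 i j : chain_adj i j -> 0 < chain_weight i j.
Proof.
rewrite /chain_adj /chain_weight; case: eqP => _ /=; first by rewrite edge_gt0.
by case: eqP => //; rewrite edge_gt0.
Qed.

Lemma chain_weight_eq0 i j : ~~ chain_adj i j -> chain_weight i j = 0.
Proof.
by rewrite /chain_adj /chain_weight negb_or => /andP[/negbTE-> /negbTE->].
Qed.

Definition chain : weighted_graph R nat :=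
  WeightedGraph chain_adj_sym chain_adj_irrefl chain_adj_finite
    chain_adj_connected chain_weight_sym chain_weight_gt0 chain_weight_eq0
    chain_mass_gt0.

Lemma weight_succ n : weight chain n n.+1 = edge n.
Proof. by rewrite /= /chain_weight eqxx. Qed.

Lemma weight_pred n : weight chain n.+1 n = edge n.
Proof. by rewrite weight_sym weight_succ. Qed.

(** One formula also covers vertex 0: there [n.-1] is [n], and [down 0 = 0] as well. *)
Lemma chain_laplacianE f n : laplacian chain f n =
  up n * (f n.+1 - f n) + down n * (f n.-1 - f n).
Proof.
have m0 := lt0r_neq0 (chain_mass_gt0 n).
rewrite /laplacian -[mass chain n]/(chain_mass n); case: n m0 => [|n] m0.
  rewrite down0 mul0r addr0 [adj _]/= chain_adj_0 -fsbig_seq// big_seq1.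
  by rewrite weight_succ /edge -mulrA mulKf.
rewrite [adj _]/= chain_adj_S -fsbig_seq; last by rewrite /= inE neq_ltn (ltnW (ltnSn _)).
rewrite big_cons big_seq1 weight_succ weight_pred -detailed_balance /edge.
move: (chain_mass _) m0 (down _) (up _) => M m0 D U.
by rewrite /= -!mulrA -mulrDr mulKf// addrC.
Qed.

Lemma chain_GammaE f g n : Gamma chain f g n =
  2^-1 * (up n * ((f n.+1 - f n) * (g n.+1 - g n))
    + down n * ((f n.-1 - f n) * (g n.-1 - g n))).
Proof.
by rewrite /Gamma !chain_laplacianE /=; move: (up n) (down n) => U D; field.
Qed.

(** [P] times the form is y (P a + s d b)^2 plus a nonnegative multiple of b^2. *)
Lemma weighted_form_ge0 (P Q s y d a b : R) : 0 < P -> 0 <= y -> 0 <= d ->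
  s ^+ 2 * y * d <= P * Q ->
  0 <= y * P * a ^+ 2 + 2 * s * y * d * (a * b) + d * Q * b ^+ 2.
Proof.
move=> P0 y0 d0 det0.
have : 0 <= y * (P * a + s * d * b) ^+ 2 + d * (P * Q - s ^+ 2 * y * d) * b ^+ 2.
  by rewrite addr_ge0// mulr_ge0 ?sqr_ge0// mulr_ge0 ?subr_ge0.
rewrite (_ : y * _ + _ = P * (y * P * a ^+ 2 + 2 * s * y * d * (a * b) + d * Q * b ^+ 2)).
  by rewrite pmulr_rge0.
by ring.
Qed.

(* Completing squares in the increments at distance two from the vertex leaves
   a quadratic form in the two increments at the vertex; it is positive
   because the [(laplacian f) ^ 2] part of Gamma2 dominates the negative
   coefficient of the downward increment. *)
Lemma chain_CD : CD chain 1 16.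
Proof.
move=> [|n] f.
  rewrite /Gamma2 (chain_laplacianE (Gamma _ _ _)) !chain_GammaE.
  rewrite !chain_laplacianE /= !down0 !downE !upS /up expr0.
  have := sqr_ge0 (f 2%N - f 1%N - (f 1%N - f 0%N)).
  have := sqr_ge0 (f 1%N - f 0%N).
  nra.
rewrite /Gamma2 (chain_laplacianE (Gamma _ _ _)) !chain_GammaE.
rewrite !chain_laplacianE /= !downE !upS.
set X := up n; have X1 : 1 <= X by exact: up_ge1.
set a := f n.+2 - f n.+1; set b := f n - f n.+1.
(* For n = 0 the truncated [n.-1] stands for a missing vertex; every term with [d] then carries the
   factor [X - 1 = 0]. *)
set c := f n.+3 - f n.+2; set d := f n.-1 - f n.
have -> : f n.+1 - f n.+2 = - a by rewrite opprB.
have -> : f n.+1 - f n = - b by rewrite opprB.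
clearbody a b c d X.
pose Y := 4 * X; pose A := 17 * Y - 4; pose B := - (11 / 4) * Y + 4.
pose dn := 2 * (Y - 1).
(* These are coefficients of twice the difference of the two sides. The square of the Laplacian
   enters with 1 from Gamma2 and -2/16 from the dimension term, hence 7/8; the -2 comes from K =
   1. *)
pose P := (A - 2) / 2 + 7 / 8 * Y.
pose Q := (B - 2) / 2 + 7 / 8 * dn.
have form0 : 0 <= Y * P * a ^+ 2 + 2 * (7 / 8) * Y * dn * (a * b) + dn * Q * b ^+ 2.
  have Y4 : 4 <= Y by rewrite /Y; lra.
  have dn0 : 0 < dn by rewrite /dn; lra.
  have P0 : 0 < P by rewrite /P /A; lra.
  have det0 : (7 / 8) ^+ 2 * Y * dn <= P * Q by rewrite /P /Q /A /B /dn; nra.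
  by apply: weighted_form_ge0 => //; lra.
rewrite -subr_ge0 (_ : _ - _ = 2^-1 * (2 * Y ^+ 2 * (c - a) ^+ 2
  + (X - 1) * dn * (d - b) ^+ 2
  + (Y * P * a ^+ 2 + 2 * (7 / 8) * Y * dn * (a * b) + dn * Q * b ^+ 2))); last first.
  by rewrite /P /Q /A /B /dn /Y; field.
rewrite mulr_ge0// addr_ge0// addr_ge0// mulr_ge0 ?sqr_ge0//.
  by rewrite mulr_ge0 ?sqr_ge0.
by rewrite mulr_ge0 ?subr_ge0// /dn /Y; lra.
Qed.

(* [Gamma eta n >= 4^n (eta n.+1 - eta n)^2 / 2], so the increments of a finitely
   supported eta are geometrically small and so is its value at 0. *)
Lemma chain_incomplete : ~ complete_graph chain.
Proof.
case=> eta [fs _ eta1 Gam].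
(* From index 127 on, Gamma is at most 1/128; the resulting bounds on the increments sum to 1/4,
   which is below the limit 1. *)
have step k n : (127 <= k)%N -> `|eta k n.+1 - eta k n| <= 2^-1 ^+ n / 8.
  move=> k127; have := Gam k n; rewrite chain_GammaE.
  rewrite -!expr2.
  have d0 : 0 <= down n * (eta k n.-1 - eta k n) ^+ 2.
    by rewrite mulr_ge0 ?sqr_ge0//; case: (n) => [|j]; rewrite ?down0// ltW// downS_gt0.
  have k1 : (k.+1%:R)^-1 <= (128%:R)^-1 :> R.
    by rewrite lef_pV2 ?posrE ?ltr0n// ler_nat.
  move=> h; rewrite -ler_sqr ?nnegrE ?mulr_ge0 ?exprn_ge0 ?invr_ge0//.
  have -> : (2^-1 ^+ n / 8) ^+ 2 = (up n)^-1 / 64 :> R.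
    have e4 : 2^-1 ^+ 2 = 4^-1 :> R by field.
    have e8 : 8 ^+ 2 = 64 :> R by ring.
    by rewrite expr_div_n -exprM mulnC exprM e4 e8 exprVn.
  rewrite real_normK ?num_real// ler_pdivlMl ?up_gt0//.
  by move: (le_trans h k1) d0; move: (up n * _) (down n * _) => y z; lra.
have near0 k N : (127 <= k)%N -> `|eta k N - eta k 0%N| <= 4^-1 - 2^-1 ^+ N / 4.
  move=> k127; elim: N => [|N IH]; first by rewrite subrr normr0 expr0; lra.
  rewrite (_ : _ - _ = (eta k N.+1 - eta k N) + (eta k N - eta k 0%N)); last by ring.
  apply: le_trans (ler_normD _ _) _; have := step k N k127; rewrite exprS; lra.
have small k : (127 <= k)%N -> eta k 0%N <= 4^-1.
  move=> k127; have [M etaM] : exists M, eta k M = 0.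
    apply: contrapT => nex; apply: infinite_nat.
    rewrite (_ : [set: nat] = [set x | eta k x != 0]); first exact: fs.
    by apply/seteqP; split=> // x _ /=; apply/eqP => ex; apply: nex; exists x.
  have := near0 k M k127; rewrite etaM sub0r normrN => /(le_trans (ler_norm _)).
  have : 0 <= 2^-1 ^+ M :> R by rewrite exprn_ge0.
  lra.
have : limn (eta^~ 0%N) <= 4^-1.
  apply: limr_le; first by apply/cvg_ex; eexists; exact: (eta1 0%N).
  by exists 127%N => // k /= /small.
by rewrite (cvg_lim _ (eta1 0%N))//; lra.
Qed.

(** * Eigenfunctions *)

Local Notation m := chain_mass.
Local Notation L := (laplacian chain).
Let m_gt0 := chain_mass_gt0.

(** The ratio decreases from 1/6 to 1/8. The upper bound makes the edge weights summable, as 4/6 <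
    1; the lower one is used through 16/8 > 1. *)
Lemma mass_ratio n : m n / 8 <= m n.+1 <= m n / 6.
Proof.
have m0 := chain_mass_gt0 n; rewrite chain_massS.
have u1 := up_ge1 n; have d0 := downS_gt0 n.
rewrite !(ler_pM2l m0); apply/andP; split.
  by rewrite ler_pdivlMr// downE upS; lra.
by rewrite ler_pdivrMr// downE upS; lra.
Qed.

Lemma mass_le n : m n <= 6^-1 ^+ n.
Proof.
elim: n => [|n IH]; first by rewrite expr0.
by rewrite exprS; have /andP[_] := mass_ratio n; lra.
Qed.

Lemma mass_ge n : 8^-1 ^+ n <= m n.
Proof.
elim: n => [|n IH]; first by rewrite expr0.
by rewrite exprS; have /andP[+ _] := mass_ratio n; lra.
Qed.

Lemma edge_le n : edge n <= (2 / 3) ^+ n.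
Proof.
rewrite /edge /up; apply: (@le_trans _ _ (6^-1 ^+ n * 4 ^+ n)).
  by rewrite ler_wpM2r ?exprn_ge0// mass_le.
by rewrite -exprMn (_ : 6^-1 * 4 = 2 / 3)//; field.
Qed.

Lemma edge_le1 n : edge n <= 1.
Proof. by apply: le_trans (edge_le n) _; rewrite exprn_ile1//; lra. Qed.

Lemma is_cvg_series_edge : cvgn (series edge).
Proof.
apply: (@series_le_cvg _ edge (geometric 1 (2 / 3))) => [n|n|n|].
- exact/ltW/edge_gt0.
- by rewrite /geometric /= mul1r exprn_ge0//; lra.
- by rewrite /geometric /= mul1r edge_le.
- by apply: is_cvg_geometric_series; rewrite ger0_norm; lra.
Qed.

Lemma edge_cvg0 : edge n @[n --> \oo] --> (0 : R).
Proof. exact: cvg_series_cvg_0 is_cvg_series_edge. Qed.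

(** The total mass is finite, since [up n >= 1] bounds each mass by a summable edge weight. *)
Lemma sqsum_bounded f (C : R) : (forall n, `|f n| <= C) -> sqsum m f.
Proof.
move=> fC; apply: (sqsum_dom (C := C) chain_mass_gt0 (g := fun=> 1)).
  by move=> n; rewrite normr1 mulr1.
apply/sqsumP; apply: (@series_le_cvg _ _ edge) => [n|n|n|].
- exact/ipt_ge0/chain_mass_gt0.
- exact/ltW/edge_gt0.
- by rewrite /ipt !mulr1 /edge ler_peMr ?up_ge1// ltW// chain_mass_gt0.
- exact: is_cvg_series_edge.
Qed.

Lemma flux_sum f N : \sum_(0 <= n < N.+1) m n * L f n = edge N * (f N.+1 - f N).
Proof.
elim: N => [|N IH].
  by rewrite big_nat1 chain_laplacianE down0 mul0r addr0 /edge mulrA.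
rewrite big_nat_recr//= IH chain_laplacianE -detailed_balance /edge /=.
by move: (m N.+1) (up N.+1) (down N.+1) => M U D; ring.
Qed.

(** By detailed balance the interior terms telescope, leaving a discrete Wronskian across the last
    edge. *)
Lemma green_sum f g N :
  \sum_(0 <= n < N.+1) (m n * (L f n * g n) - m n * (f n * L g n))
  = edge N * (f N.+1 * g N - f N * g N.+1).
Proof.
elim: N => [|N IH].
  rewrite big_nat1 !chain_laplacianE down0 /edge.
  by move: (m 0) (up 0) => M U; ring.
rewrite big_nat_recr//= IH !chain_laplacianE -detailed_balance /edge /=.
by move: (m N.+1) (up N.+1) (down N.+1) => M U D; ring.
Qed.

Lemma green f g : sqsum m f -> sqsum m g -> sqsum m (L f) -> sqsum m (L g) ->
  edge N * (f N.+1 * g N - f N * g N.+1) @[N --> \oo] --> (0 : R) ->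
  ip m (L f) g = ip m f (L g).
Proof.
move=> cf cg clf clg bd.
have c1 := ip_cvg chain_mass_gt0 clf cg.
have c2 := ip_cvg chain_mass_gt0 cf clg.
apply/eqP; rewrite -subr_eq0 /ip -lim_seriesB//; apply/eqP/cvg_lim => //.
rewrite -(cvg_shiftS (series _)); apply: cvg_trans bd.
by apply: near_eq_cvg; near=> N; rewrite -green_sum.
Unshelve. all: by end_near. Qed.

Definition xi n : R := (up n)^-1.
Definition lam k : R := 2 * (4 ^+ k - 1).
Definition low k : R := (4 ^+ k - 1) * (2 - 4^-1 ^+ k).

Lemma xi_gt0 n : 0 < xi n. Proof. by rewrite invr_gt0 up_gt0. Qed.
Lemma xi_le1 n : xi n <= 1. Proof. by rewrite invf_le1 ?up_gt0 ?up_ge1. Qed.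
Lemma xiS n : xi n.+1 = 4^-1 * xi n. Proof. by rewrite /xi upS invfM. Qed.

Lemma xi_cvg0 : xi n @[n --> \oo] --> (0 : R).
Proof.
rewrite (_ : (fun n => xi n) = geometric 1 4^-1).
  by apply: cvg_geometric; rewrite ger0_norm; lra.
by apply/funext => n; rewrite /geometric /= mul1r exprVn.
Qed.

Lemma lam0 : lam 0 = 0. Proof. by rewrite /lam expr0 subrr mulr0. Qed.
Lemma low0 : low 0 = 0. Proof. by rewrite /low expr0 subrr mul0r. Qed.

Lemma lam_ge0 k : 0 <= lam k.
Proof. by rewrite /lam; have := up_ge1 k; rewrite /up; lra. Qed.

Lemma lam_lt i k : (i < k)%N -> lam i < lam k.
Proof.
by move=> ik; rewrite /lam ltr_pM2l// ltrD2r ltr_eXn2l//; lra.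
Qed.

Lemma lam_inj i k : lam i = lam k -> i = k.
Proof.
by move=> E; case: (ltngtP i k) => // /lam_lt; rewrite E ltxx.
Qed.

Lemma lowS_gt0 k : 0 < low k.+1.
Proof.
rewrite /low mulr_gt0//.
  by rewrite exprS; have := up_ge1 k; rewrite /up; lra.
have : 4^-1 ^+ k.+1 <= 1 :> R by rewrite exprn_ile1//; lra.
lra.
Qed.

(** A step along the chain scales [xi] by 4 or 1/4, and both rates are affine in 1/xi. The 1/xi
    parts lower the degree by one; the constant part of [down] gives the eigenvalue. *)
Lemma laplacian_monomial k n :
  L (fun n => xi n ^+ k) n = low k * xi n ^+ k.-1 - lam k * xi n ^+ k.
Proof.
case: k => [|k].
  by rewrite chain_laplacianE lam0 low0 !expr0 subrr !mulr0 !mul0r addr0 subr0.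
rewrite chain_laplacianE xiS -[k.+1.-1]/k.
have uE : up n = (xi n)^-1 by rewrite invrK.
have -> : down n * (xi n.-1 ^+ k.+1 - xi n ^+ k.+1) =
    down n * ((4 ^+ k.+1 - 1) * xi n ^+ k.+1).
  (* At vertex 0 the relation [xi n.-1 = 4 * xi n] fails, but its coefficient [down 0] is 0. *)
  case: n {uE} => [|n]; first by rewrite down0 !mul0r.
  rewrite -[n.+1.-1]/n (_ : xi n = 4 * xi n.+1) ?xiS; last by field.
  by rewrite exprMn mulrBl mul1r.
rewrite downE uE exprMn /low /lam (exprS (xi n) k) exprVn.
have x0 := lt0r_neq0 (xi_gt0 n); have b0 := lt0r_neq0 (up_gt0 k.+1).
move: (xi n) (xi n ^+ k) x0 => x y x0; rewrite /up in b0.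
move: (4 ^+ k.+1) b0 => b b0; field.
by rewrite x0 b0.
Qed.

(* Little q-Laguerre polynomials with q = 1/4, normalised to be 1 at xi = 0. *)
Fixpoint pcoef k i : R :=
  if i is i'.+1 then pcoef k i' * ((lam i' - lam k) / low i'.+1) else 1.

Definition eigenpoly k n : R := \sum_(0 <= i < k.+1) pcoef k i * xi n ^+ i.

Lemma laplacian_comb (I : Type) (r : seq I) (a : I -> R) (F : I -> nat -> R) n :
  L (fun n => \sum_(i <- r) a i * F i n) n = \sum_(i <- r) a i * L (F i) n.
Proof.
rewrite chain_laplacianE -!sumrB !mulr_sumr -big_split/=.
apply: eq_bigr => i _; rewrite chain_laplacianE.
by move: (up n) (down n) => U D; ring.
Qed.

Lemma laplacian_eigenpoly k n : L (eigenpoly k) n = - lam k * eigenpoly k n.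
Proof.
rewrite /eigenpoly laplacian_comb mulr_sumr.
under eq_bigr do rewrite laplacian_monomial mulrBr.
rewrite sumrB big_nat_recl// low0 mul0r mulr0 add0r /=.
(* The recursion for [pcoef] cancels [low]; the sum can be extended to i = k because the new term
   has the factor [lam k - lam k]. *)
have -> : \sum_(0 <= i < k) pcoef k i.+1 * (low i.+1 * xi n ^+ i) =
   \sum_(0 <= i < k.+1) pcoef k i * (lam i - lam k) * xi n ^+ i.
  rewrite big_nat_recr//= subrr mulr0 mul0r addr0; apply: eq_bigr => i _ /=.
  have := lt0r_neq0 (lowS_gt0 i); move: (low _) => l l0.
  by rewrite -!mulrA mulKf.
rewrite -sumrB; apply: eq_bigr => i _; ring.
Qed.

Definition pbound k : R := \sum_(0 <= i < k.+1) `|pcoef k i|.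

Lemma eigenpoly_bound k n : `|eigenpoly k n| <= pbound k.
Proof.
apply: le_trans (ler_norm_sum _ _ _) _; apply: ler_sum => i _.
by rewrite normrM ler_piMr// ger0_norm ?exprn_ge0 ?exprn_ile1 ?xi_le1// ltW// xi_gt0.
Qed.

Lemma pbound_ge0 k : 0 <= pbound k.
Proof. exact: le_trans (eigenpoly_bound k 0). Qed.

Lemma eigenpoly_lipschitz k n :
  `|eigenpoly k n.+1 - eigenpoly k n| <= pbound k * xi n.
Proof.
rewrite -sumrB mulr_suml; apply: le_trans (ler_norm_sum _ _ _) _.
apply: ler_sum => i _; rewrite -mulrBr normrM ler_wpM2l// xiS exprMn.
case: i => [|i]; first by rewrite !expr0 mul1r subrr normr0 ltW// xi_gt0.
have x0 := xi_gt0 n; have x1 := xi_le1 n.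
have a0 : 0 <= 4^-1 ^+ i.+1 :> R by rewrite exprn_ge0.
have a1 : 4^-1 ^+ i.+1 <= 1 :> R by rewrite exprn_ile1//; lra.
have b0 : 0 <= xi n ^+ i by rewrite exprn_ge0// ltW.
have b1 : xi n ^+ i <= 1 by rewrite exprn_ile1// ltW.
have X0 : 0 <= xi n ^+ i.+1 by rewrite exprn_ge0// ltW.
have X1 : xi n ^+ i.+1 <= xi n by rewrite exprS ler_piMr// ltW.
by move: (xi n ^+ i.+1) (4^-1 ^+ i.+1) X0 X1 a0 a1 => X a *; rewrite distrC ger0_norm; nra.
Qed.

Lemma sqsum_eigenpoly k : sqsum m (eigenpoly k).
Proof. exact: sqsum_bounded (eigenpoly_bound k). Qed.

Lemma sqsum_laplacian_eigenpoly k : sqsum m (L (eigenpoly k)).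
Proof.
rewrite (_ : L _ = fun n => - lam k * eigenpoly k n).
  exact/sqsumZ/sqsum_eigenpoly/chain_mass_gt0.
by apply/funext => n; exact: laplacian_eigenpoly.
Qed.

Lemma eigenpoly0 n : eigenpoly 0 n = 1.
Proof. by rewrite /eigenpoly big_nat1 expr0 mulr1. Qed.

Lemma eigenpoly_cvg1 k : eigenpoly k n @[n --> \oo] --> (1 : R).
Proof.
have -> : (fun n => eigenpoly k n) =
    (fun n => 1 + xi n * \sum_(0 <= i < k) pcoef k i.+1 * xi n ^+ i).
  apply/funext => n; rewrite /eigenpoly big_nat_recl// expr0 mulr1 mulr_sumr.
  by congr (_ + _); apply: eq_bigr => i _; rewrite exprS mulrCA.
rewrite -[X in _ --> X]addr0; apply: cvgD; first exact: cvg_cst.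
apply/cvgr0Pnorm_le => e e0.
pose C := \sum_(0 <= i < k) `|pcoef k i.+1|.
have C0 : 0 <= C by rewrite sumr_ge0.
near=> n.
have xe : xi n <= e / (C + 1).
  rewrite -(ger0_norm (ltW (xi_gt0 n))); near: n.
  by apply: (cvgr0_norm_le _ xi_cvg0); rewrite divr_gt0// ltr_wpDl.
rewrite normrM ger0_norm ?(ltW (xi_gt0 n))//.
apply: (@le_trans _ _ (xi n * C)).
  rewrite ler_wpM2l ?(ltW (xi_gt0 n))//; apply: le_trans (ler_norm_sum _ _ _) _.
  apply: ler_sum => i _.
  by rewrite normrM ler_piMr// ger0_norm ?exprn_ge0 ?exprn_ile1 ?xi_le1// ltW// xi_gt0.
apply: (@le_trans _ _ (e / (C + 1) * C)); first by rewrite ler_wpM2r.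
by rewrite mulrAC ler_pdivrMr ?ltr_wpDl// ler_pM2l//; lra.
Unshelve. all: by end_near. Qed.

(** The Wronskian at infinity vanishes, as the polynomials converge and the edge weights tend to 0;
    distinct eigenvalues then force orthogonality. *)
Lemma eigenpoly_orth k l : k != l -> ip m (eigenpoly k) (eigenpoly l) = 0.
Proof.
move=> kl; have := @green (eigenpoly k) (eigenpoly l).
move=> /(_ (sqsum_eigenpoly _) (sqsum_eigenpoly _)).
move=> /(_ (sqsum_laplacian_eigenpoly _) (sqsum_laplacian_eigenpoly _)).
have -> : L (eigenpoly k) = fun n => - lam k * eigenpoly k n.
  by apply/funext => n; exact: laplacian_eigenpoly.
have -> : L (eigenpoly l) = fun n => - lam l * eigenpoly l n.
  by apply/funext => n; exact: laplacian_eigenpoly.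
rewrite (ipC _ (eigenpoly k) (fun _ => _)).
rewrite !(ipZl chain_mass_gt0 _ (sqsum_eigenpoly _) (sqsum_eigenpoly _)).
rewrite (ipC _ (eigenpoly l)) => H.
have {}H : - lam k * ip m (eigenpoly k) (eigenpoly l)
         = - lam l * ip m (eigenpoly k) (eigenpoly l).
  apply: H; rewrite -[X in _ --> X](mul0r (1 * 1 - 1 * 1)).
  have cS j : eigenpoly j n.+1 @[n --> \oo] --> (1 : R).
    by rewrite (cvg_shiftS (eigenpoly j)); exact: eigenpoly_cvg1.
  apply: cvgM; first exact: edge_cvg0.
  by apply: cvgB; apply: cvgM => //; exact: eigenpoly_cvg1.
apply/eqP; have : (lam l - lam k) * ip m (eigenpoly k) (eigenpoly l) = 0 by lra.
move/eqP; rewrite mulf_eq0 subr_eq0 => /orP[/eqP/lam_inj E|//].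
by rewrite E eqxx in kl.
Qed.

(** A polynomial of norm 0 would vanish at every vertex, against its limit 1 at infinity. *)
Lemma eigenpoly_norm_gt0 k : 0 < ip m (eigenpoly k) (eigenpoly k).
Proof.
rewrite lt_def (ip_ge0 m_gt0 (sqsum_eigenpoly k)) andbT.
apply/eqP => p0.
have z n : eigenpoly k n = 0.
  have := ip_term chain_mass_gt0 n (sqsum_eigenpoly k).
  rewrite p0 pmulr_rle0 ?chain_mass_gt0// => h.
  by apply/eqP; rewrite -sqrf_eq0 eq_le h sqr_ge0.
have : limn (eigenpoly k) = 1 by apply: cvg_lim => //; exact: eigenpoly_cvg1.
rewrite (_ : eigenpoly k = fun=> 0); last by apply/funext.
by rewrite lim_cst// => /eqP; rewrite eq_sym oner_eq0.
Qed.

Definition nu k : R := (ip m (eigenpoly k) (eigenpoly k))^-1.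

Lemma nu_gt0 k : 0 < nu k. Proof. by rewrite invr_gt0 eigenpoly_norm_gt0. Qed.

Lemma eigenpoly_ip k l :
  ip m (eigenpoly k) (eigenpoly l) = if k == l then (nu k)^-1 else 0.
Proof. by case: eqVneq => [->|/eigenpoly_orth//]; rewrite invrK. Qed.

Lemma pcoef_neq0 k i : (i <= k)%N -> pcoef k i != 0.
Proof.
elim: i => [|i IH] ik /=; first exact: oner_neq0.
rewrite mulf_neq0 ?IH ?(ltnW ik)// mulf_neq0//.
  by rewrite lt_eqF// subr_lt0 lam_lt.
by rewrite invr_neq0// gt_eqF// lowS_gt0.
Qed.

Lemma sqsum_xi k : sqsum m (fun n => xi n ^+ k).
Proof.
apply: (@sqsum_bounded _ 1) => n.
by rewrite ger0_norm ?exprn_ge0 ?exprn_ile1 ?xi_le1// ltW// xi_gt0.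
Qed.

(** The passage from monomials to eigenpolynomials is triangular with nonzero diagonal [pcoef k k],
    so induction on the degree inverts it. *)
Lemma eigenpoly_moments f : sqsum m f -> (forall k, ip m (eigenpoly k) f = 0) ->
  forall k, ip m (fun n => xi n ^+ k) f = 0.
Proof.
move=> cf pf; elim/ltn_ind => k IH.
have sum_ip j : sqsum m (fun n => \sum_(0 <= i < j) pcoef k i * xi n ^+ i) /\
    ip m (fun n => \sum_(0 <= i < j) pcoef k i * xi n ^+ i) f =
    \sum_(0 <= i < j) pcoef k i * ip m (fun n => xi n ^+ i) f.
  elim: j => [|j [cj IHj]].
    rewrite (_ : (fun n => _) = fun=> 0); last by apply/funext => n; rewrite big_nil.
    split; first by apply: (@sqsum_finite _ _ _ 0).
    by rewrite big_nil ipC (proj2 (@series_finite _ _ _ _ 0 _))// /series /= big_nil.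
  rewrite (_ : (fun n => _) = fun n => \sum_(0 <= i < j) pcoef k i * xi n ^+ i
     + pcoef k j * xi n ^+ j); last by apply/funext => n; rewrite big_nat_recr.
  have cx := sqsumZ chain_mass_gt0 (pcoef k j) (sqsum_xi j).
  split; first by apply: sqsumD => //; exact: chain_mass_gt0.
  rewrite (ipDl chain_mass_gt0 cj cx cf) IHj big_nat_recr//=.
  by rewrite (ipZl chain_mass_gt0 _ (sqsum_xi j) cf).
have := pf k; rewrite /eigenpoly (sum_ip k.+1).2 big_nat_recr//= big_nat big1 ?add0r.
  by move/eqP; rewrite mulf_eq0 (negbTE (pcoef_neq0 _))//= => /eqP.
by move=> i /andP[_ ik]; rewrite IH// mulr0.
Qed.

(* Dividing the k-th moment by [xi n ^+ k] isolates, as k grows, the first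
   vertex at which f does not vanish. *)
Lemma eigenpoly_total f : sqsum m f -> (forall k, coord m eigenpoly f k = 0) ->
  forall x, f x = 0.
Proof.
move=> cf /(eigenpoly_moments cf) mom; elim/ltn_ind => n IH.
have caf : sqsum m (fun x => `|f x|).
  by apply: (sqsum_dom (C := 1) chain_mass_gt0 _ cf) => x; rewrite normr_id mul1r.
have c1 : sqsum m (fun=> 1) by apply: (@sqsum_bounded _ 1) => ?; rewrite normr1.
pose S := limn (series (ipt m (fun=> 1) (fun x => `|f x|))).
have t0 x : 0 <= ipt m (fun=> 1) (fun x => `|f x|) x.
  by rewrite /ipt mul1r mulr_ge0// ltW// chain_mass_gt0.
have partS N : series (ipt m (fun=> 1) (fun x => `|f x|)) N <= S.
  by apply: series_le_lim => //; exact: (ip_cvg chain_mass_gt0 c1 caf).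
have S0 : 0 <= S by apply: le_trans (partS 0%N); rewrite /series /= big_nil.
(* The moment is 0 and so are the terms before [n], so the n-th term is minus the tail, on which
   [xi] is at most [xi n / 4]. [S] is the l^1 norm of [f]. *)
have key k : m n * `|f n| <= 4^-1 ^+ k * S.
  have xk0 : 0 < xi n ^+ k by rewrite exprn_gt0// xi_gt0.
  rewrite -(ler_pM2l xk0) [leRHS]mulrA -exprMn (mulrC (xi n)) -xiS.
  have h := ip_cvgP chain_mass_gt0 (sqsum_xi k) cf.
  rewrite mom in h.
  have h2 : `|series (ipt m (fun n => xi n ^+ k) f) N - xi n ^+ k * (m n * f n)| @[N --> \oo]
     --> `|0 - xi n ^+ k * (m n * f n)|.
    by apply: cvg_norm; apply: cvgB => //; exact: cvg_cst.
  rewrite sub0r normrN !normrM (gtr0_norm xk0) (gtr0_norm (chain_mass_gt0 n)) in h2.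
  rewrite -(cvg_lim _ h2)//; apply: limr_le; first by apply/cvg_ex; eexists; exact: h2.
  near=> N; have nN : (n < N)%N by near: N; exact: nbhs_infty_gt.
  rewrite /series /= (big_cat_nat (leq0n n.+1) (nN : n.+1 <= N)%N)//= big_nat_recr//=.
  rewrite big_nat big1 ?add0r; last by move=> i /andP[_ /IH fi]; rewrite /ipt fi !mulr0.
  rewrite {1}/ipt mulrCA addrAC subrr add0r.
  apply: le_trans (ler_norm_sum _ _ _) _.
  apply: (@le_trans _ _ (xi n.+1 ^+ k * \sum_(n.+1 <= i < N) ipt m (fun=> 1) (fun x => `|f x|) i)).
    rewrite mulr_sumr !big_nat; apply: ler_sum => i /andP[ni _].
    rewrite /ipt mul1r !normrM (gtr0_norm (chain_mass_gt0 _)) mulrCA.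
    rewrite ler_wpM2r// ?mulr_ge0 ?(ltW (chain_mass_gt0 _))//.
    rewrite ger0_norm ?exprn_ge0 ?(ltW (xi_gt0 _))// lerXn2r ?nnegrE ?(ltW (xi_gt0 _))//.
    by rewrite lef_pV2 ?posrE ?up_gt0// /up ler_eXn2l//; lra.
  rewrite ler_wpM2l ?exprn_ge0 ?(ltW (xi_gt0 _))//; apply: le_trans (partS N).
  rewrite /series /= [leRHS](big_cat_nat (leq0n n.+1) (nN : n.+1 <= N)%N)//= lerDr.
  by rewrite sumr_ge0.
have lim0 : 4^-1 ^+ k * S @[k --> \oo] --> (0 : R).
  rewrite -[X in _ --> X](mul0r S); apply: cvgMl.
  by apply: cvg_expr; rewrite ger0_norm; lra.
have : m n * `|f n| <= 0.
  rewrite -(cvg_lim _ lim0)//; apply: limr_ge; first by apply/cvg_ex; eexists; exact: lim0.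
  by near=> k; exact: key.
by rewrite pmulr_rle0 ?chain_mass_gt0// normr_le0 => /eqP.
Unshelve. all: by end_near. Qed.


(** * The Dirichlet Laplacian and its semigroup *)

Let iptE f : (fun x => m x * f x ^+ 2) = ipt m f f.
Proof. by apply/funext => x; rewrite expr2. Qed.

Lemma l2norm2E f : sqsum m f -> l2norm2 chain f = (ip m f f)%:E.
Proof.
move=> /sqsumP cf; rewrite /l2norm2 -[RHS]esum_nat_lim//.
exact: ipt_ge0.
Qed.

Lemma l2P f : l2 chain f <-> sqsum m f.
Proof.
split=> [h|/l2norm2E E]; last by rewrite /l2 E ltry.
apply/sqsumP; rewrite -iptE; apply: esum_nat_cvg => // n.
by rewrite mulr_ge0 ?sqr_ge0// ltW.
Qed.

Lemma energyE f :
  energy chain f = (\esum_(j in [set: nat]) (edge j * (f j - f j.+1) ^+ 2)%:E)%E.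
Proof.
pose a (e : nat * nat) : \bar R := (2^-1 * (weight chain e.1 e.2 * (f e.1 - f e.2) ^+ 2))%:E.
have w0 i j : 0 <= weight chain i j.
  by case: (boolP (adj chain i j)) => [/weight_gt0/ltW|/weight_eq0 ->].
have a0 e : (0 <= a e)%E by rewrite lee_fin mulr_ge0// mulr_ge0 ?sqr_ge0.
(* [B1] and [B2] are the two orientations of the edges; all remaining pairs have weight 0. *)
pose B1 := range (fun j : nat => (j, j.+1)); pose B2 := range (fun j : nat => (j.+1, j)).
rewrite /energy (esumID B1 _ a)// !setTI (esumID B2 (~` B1) a)//.
have -> : ~` B1 `&` B2 = B2.
  rewrite setIC; apply/setIidPl => _ [j _ <-] [i _ [-> /eqP]].
  by rewrite eqn_leq ltnNge leqnSn.
rewrite [X in (_ + (_ + X))%E]esum1 ?adde0; last first.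
  move=> [i j] [n1 n2]; rewrite /a [weight _ _ _]weight_eq0 ?mul0r ?mulr0//=.
  rewrite /chain_adj negb_or; apply/andP; split; apply/eqP => E.
    by apply: n1; exists i; rewrite ?E.
  by apply: n2; exists j; rewrite ?E.
rewrite !esum_image; [|by move=> i j _ _ []..].
rewrite -esumD; [|by move=> *; exact: a0..].
apply: eq_esum => j _; rewrite /a !weight_succ !weight_pred -EFinD; congr (_%:E).
by field.
Qed.

Lemma energy_lim f : cvgn (series (fun j => edge j * (f j - f j.+1) ^+ 2)) ->
  energy chain f = (limn (series (fun j => edge j * (f j - f j.+1) ^+ 2)))%:E.
Proof.
move=> cf; rewrite energyE esum_nat_lim// => j.
by rewrite mulr_ge0 ?sqr_ge0// ltW// edge_gt0.
Qed.

Lemma finsupp_cutoff N f : finsupp (cutoff N f).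
Proof.
apply: (sub_finite_set (B := `I_N)); last exact: finite_II.
by move=> n /=; rewrite /cutoff; case: ifP => //; rewrite eqxx.
Qed.

(* The edge weights are summable and tend to 0, so cutting a bounded function
   off at a single edge is cheap. *)
Lemma bounded_form_domain u (C : R) : (forall n, `|u n| <= C) ->
  dirichlet_form_domain chain u.
Proof.
move=> uC; have cu := sqsum_bounded uC; split; first exact/l2P.
have C0 : 0 <= C := le_trans (normr_ge0 _) (uC 0%N).
pose b : R^nat := (4 * C ^+ 2) *: (edge : R^nat).
pose v N n := u n - cutoff N u n.
pose a N : R^nat := fun j => edge j * (v N j - v N j.+1) ^+ 2.
have cb : cvgn (series b) by apply: is_cvg_seriesZ; exact: is_cvg_series_edge.
have vC N n : `|v N n| <= C.
  by rewrite /v /cutoff; case: ifP => _; rewrite ?subrr ?normr0 ?subr0.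
have ab N j : 0 <= a N j <= b j.
  rewrite mulr_ge0 ?sqr_ge0 ?(ltW (edge_gt0 _))//= -[b j]/(4 * C ^+ 2 * edge j) [leRHS]mulrC.
  rewrite ler_wpM2l ?(ltW (edge_gt0 _))//.
  have := vC N j; have := vC N j.+1; rewrite !ler_norml => /andP[h1 h2] /andP[h3 h4]; nra.
have ca N : cvgn (series (a N)).
  apply: (series_le_cvg _ _ _ cb) => n; case/andP: (ab N n) => // h1 h2.
  exact: le_trans h2.
exists (fun N => cutoff N u); first by move=> N; exact: finsupp_cutoff.
rewrite (_ : (fun N => _) = fun N => (ip m (v N) (v N) + limn (series (a N)))%:E).
  apply/cvg0_EFin; rewrite -[X in _ --> X](addr0 0); apply: cvgD.
    exact: cvg_cutoff.
  apply: (cvg_dominated_series cb); first by apply: nearW => N j; exact: ab.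
  move=> j; apply: cvg_near_cst; near=> N; rewrite /a /v /cutoff.
  have jN : (j.+1 < N)%N by near: N; exact: nbhs_infty_gt.
  by rewrite jN (ltnW jN) !subrr expr0n mulr0.
apply/funext => N; rewrite EFinD; congr (_ + _)%E; last exact: (energy_lim (ca N)).
by apply: l2norm2E; apply: sqsumB => //; exact: sqsum_cutoff.
Unshelve. all: by end_near. Qed.

(** Beyond the support of one approximant at finite distance, the energy terms are those of [u], so
    they tend to 0. As [edge N <= 1], they dominate the squared flux. *)
Lemma form_domain_flux u : dirichlet_form_domain chain u ->
  edge N * (u N.+1 - u N) @[N --> \oo] --> (0 : R).
Proof.
case=> _ [phi fphi /fine_cvgP[/filter_ex[n fin] _]].
move: fin; rewrite fin_numD => /andP[_ fin].
have [M phi0] := finite_set_nat_bound (fphi n).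
have {}phi0 j : (M <= j)%N -> phi n j = 0.
  move=> Mj; apply: contrapT => /eqP /phi0; by rewrite ltnNge Mj.
have : cvgn (series (fun j => edge j * ((u \- phi n) j - (u \- phi n) j.+1) ^+ 2)).
  apply: esum_nat_cvg => [j|]; first by rewrite mulr_ge0 ?sqr_ge0// ltW// edge_gt0.
  by rewrite -energyE ltey_eq fin.
move=> /cvg_series_cvg_0/cvgr0Pnorm_le h; apply/cvgr0Pnorm_le => e e0.
near=> N.
have MN : (M <= N)%N by near: N; exact: nbhs_infty_ge.
have : `|edge N * ((u \- phi n) N - (u \- phi n) N.+1) ^+ 2| <= e ^+ 2.
  by near: N; apply: h; rewrite exprn_gt0.
rewrite /= !phi0 ?(leqW MN)// !subr0 ger0_norm; last first.
  by rewrite mulr_ge0 ?sqr_ge0// ltW// edge_gt0.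
move=> le2; rewrite -ler_sqr ?nnegrE ?(ltW e0)// real_normK ?num_real//.
apply: le_trans le2; rewrite exprMn -(sqrrN (u N - _)) opprB expr2 -mulrA ler_piMl ?edge_le1//.
by rewrite mulr_ge0 ?sqr_ge0// ltW// edge_gt0.
Unshelve. all: by end_near. Qed.

Lemma sqsum_mass_cvg0 u : sqsum m u -> m N * u N @[N --> \oo] --> (0 : R).
Proof.
move=> cu; have c1 : sqsum m (fun=> 1) by apply: (@sqsum_bounded _ 1) => ?; rewrite normr1.
have := cvg_series_cvg_0 (ip_cvg m_gt0 cu c1).
by rewrite /ipt; under eq_fun do rewrite mulr1.
Qed.

Lemma coord_laplacian u k : dirichlet_form_domain chain u -> sqsum m (L u) ->
  coord m eigenpoly (L u) k = - lam k * coord m eigenpoly u k.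
Proof.
move=> du clu; have cu : sqsum m u by apply/l2P; case: du.
have cp := sqsum_eigenpoly k.
rewrite /coord ipC (green cu cp clu (sqsum_laplacian_eigenpoly k)).
  rewrite ipC (_ : L _ = fun n => - lam k * eigenpoly k n).
    by rewrite (ipZl m_gt0 _ cp cu).
  by apply/funext => n; exact: laplacian_eigenpoly.
(* The Wronskian splits into a flux of [u], which vanishes on the form domain, and a polynomial
   increment of order [xi N]; the latter cancels [up N] inside [edge N] and leaves [m N * u N]. *)
rewrite (_ : (fun N => _) = fun N => edge N * (u N.+1 - u N) * eigenpoly k N
    - edge N * u N * (eigenpoly k N.+1 - eigenpoly k N)); last first.
  by apply/funext => N; move: (edge N) => e; ring.
rewrite -[X in _ --> X]subr0; apply: cvgB.
  rewrite -[X in _ --> X](mul0r 1); apply: cvgM; last exact: eigenpoly_cvg1.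
  exact: form_domain_flux.
apply/cvgr0Pnorm_le => e e0.
have b0 := pbound_ge0 k.
have e1 : 0 < e / (pbound k + 1) by rewrite divr_gt0// ltr_wpDl.
near=> N.
have h : `|m N * u N| <= e / (pbound k + 1).
  by near: N; exact: (cvgr0_norm_le _ (sqsum_mass_cvg0 cu)).
rewrite normrM; apply: le_trans (ler_wpM2l (normr_ge0 _) (eigenpoly_lipschitz _ _)) _.
rewrite /edge /xi mulrAC normrM (gtr0_norm (up_gt0 _)) mulrCA.
rewrite (_ : _ * (_ * _) = `|m N * u N| * pbound k); last first.
  have := lt0r_neq0 (up_gt0 N); move: (up N) `|m N * u N| (pbound k) => a c d a0.
  by field.
apply: le_trans (ler_wpM2r b0 h) _.
by rewrite mulrAC ler_pdivrMr ?ltr_wpDl// ler_pM2l//; lra.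
Unshelve. all: by end_near. Qed.

Lemma laplacian_synth_part (c : nat -> R) N x :
  L (synth_part nu eigenpoly c N) x
  = synth_part nu eigenpoly (fun k => - lam k * c k) N x.
Proof.
rewrite /synth_part /series /= (_ : (fun x => _) = fun x =>
   \sum_(0 <= k < N) (nu k * c k) * eigenpoly k x); last first.
  by apply/funext => y; apply: eq_bigr => k _; rewrite /ipt mulrA.
rewrite laplacian_comb; apply: eq_bigr => k _.
by rewrite laplacian_eigenpoly /ipt; ring.
Qed.

Lemma laplacian_cvg (F : nat -> nat -> R) u x : (forall y, F N y @[N --> \oo] --> u y) ->
  L (F N) x @[N --> \oo] --> L u x.
Proof.
move=> Fu; under eq_fun do rewrite chain_laplacianE.
by rewrite chain_laplacianE; apply: cvgD; apply: cvgMr; apply: cvgB.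
Qed.

(** The spectral expansions converge pointwise, and the Laplacian at a vertex involves only finitely
    many values, so it passes to the limit. *)
Lemma spectral_laplacian u g : sqsum m u -> sqsum m g ->
  (forall k, coord m eigenpoly g k = - lam k * coord m eigenpoly u k) -> g = L u.
Proof.
move=> cu cg E; apply/funext => x.
have S f : sqsum m f -> forall y,
    synth_part nu eigenpoly (coord m eigenpoly f) N y @[N --> \oo] --> f y.
  move=> cf y.
  rewrite -[f in X in _ --> X](synth_coord m_gt0 nu_gt0 sqsum_eigenpoly eigenpoly_ip eigenpoly_total cf).
  apply: (synth_part_cvg m_gt0 nu_gt0 sqsum_eigenpoly eigenpoly_ip).
  exact: (proj1 (bessel m_gt0 nu_gt0 sqsum_eigenpoly eigenpoly_ip cf)).
have h1 := laplacian_cvg (x := x) (S _ cu).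
have h2 := S _ cg x.
rewrite -(cvg_lim _ h2)// -(cvg_lim _ h1)//; congr (limn _); apply/funext => N.
by rewrite laplacian_synth_part; congr synth_part; exact/funext.
Qed.

Lemma mass_tail N X : \sum_(N.+1 <= j < X) m j <= m N.
Proof.
have [NX|XN] := leqP N.+1 X; last by rewrite big_geq ?(ltnW XN)// ltW.
(* Subtracting the last mass makes the induction close: each mass is at least twice the next. *)
have : \sum_(N.+1 <= j < X) m j <= m N - m X.-1.
  rewrite -(subnK NX) ; elim: (X - N.+1)%N => [|j IH].
    by rewrite add0n big_geq// subrr.
  rewrite addSn big_nat_recr ?leq_addl//=.
  have := mass_ratio (j + N); have := m_gt0 (j + N)%N.
  rewrite addnS /= in IH *.
  by move=> ? /andP[_ ?]; lra.
by have := m_gt0 X.-1; lra.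
Qed.

(* [edge N * (u N.+1 - u N)] is the tail sum of [m * L u], hence at most
   [sqrt (m N)] times a constant, while [edge N] is [m N * 4 ^ N]. *)
Lemma domain_bounded u g : sqsum m u -> sqsum m g -> g = L u ->
  ip m g (fun=> 1) = 0 -> exists C : R, forall n, `|u n| <= C.
Proof.
move=> cu cg E g1; pose B := ip m g g; have B0 : 0 <= B by exact: ip_ge0.
have c1 : sqsum m (fun=> 1) by apply: (@sqsum_bounded _ 1) => ?; rewrite normr1.
(* [B + 1] and 3/4 replace the square roots of [B] and 1/2: B <= (B + 1)^2 and 1/2 <= (3/4)^2. *)
have step N : `|u N.+1 - u N| <= (B + 1) * (3 / 4) ^+ N.
  have cc := sqsum_cutoff m N.+1 (fun=> 1 : R).
  pose h n : R := 1 - cutoff N.+1 (fun=> 1 : R) n.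
  have ch : sqsum m h by exact: sqsumB.
  have hh : ip m h h <= m N.
    apply: (proj2 (sqsum_bound m_gt0 _)) => X; apply: le_trans (mass_tail N X).
    have hE n : ipt m h h n = if (n <= N)%N then 0 else m n.
      rewrite /ipt /h /cutoff ltnS; case: ifP => _; first by rewrite subrr !mulr0.
      by rewrite subr0 !mulr1.
    rewrite /series /=; under eq_bigr do rewrite hE.
    have [NX|XN] := leqP N.+1 X.
      rewrite (big_cat_nat (leq0n N.+1) NX)/= big_nat big1 ?add0r; last first.
        by move=> i /andP[_ iN]; rewrite -ltnS iN.
      by rewrite !big_nat; apply: ler_sum => i /andP[Ni _]; rewrite leqNgt Ni.
    rewrite big_nat big1 ?big_geq ?(ltnW XN)// => i /andP[_ iX].
    by rewrite (leq_trans (ltnW iX) XN).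
  have gh : ip m g h = - (edge N * (u N.+1 - u N)).
    rewrite ipC (ipBl m_gt0 c1 cc cg) ipC g1 ipC sub0r; congr (- _).
    rewrite -flux_sum -E (proj2 (@series_finite _ _ _ _ N.+1 _)); last first.
      by move=> n Nn; rewrite /cutoff ltnNge Nn.
    rewrite /series /=; apply: eq_big_nat => n /andP[_ nN].
    by rewrite /ipt /cutoff nN mulr1.
  have := ip_CS m_gt0 cg ch; rewrite gh sqrrN -/B => le1.
  have {}le1 : (edge N * (u N.+1 - u N)) ^+ 2 <= B * m N.
    by apply: le_trans le1 _; rewrite ler_wpM2l.
  have mN := m_gt0 N; have uN := up_gt0 N.
  have {}le1 : (u N.+1 - u N) ^+ 2 <= B * 2^-1 ^+ N.
    have h1 : m N * up N ^+ 2 * (u N.+1 - u N) ^+ 2 <= B.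
      rewrite -(ler_pM2l mN) [leRHS]mulrC; apply: le_trans le1.
      rewrite /edge; move: (m N) (up N) => x y.
      by rewrite le_eqVlt; apply/orP; left; apply/eqP; ring.
    have h2 : 2 ^+ N <= m N * up N ^+ 2.
      apply: (@le_trans _ _ (8^-1 ^+ N * up N ^+ 2)); last first.
        by rewrite ler_wpM2r ?sqr_ge0// mass_ge.
      rewrite /up -exprM mulnC exprM -exprMn.
      by rewrite (_ : 8^-1 * 4 ^+ 2 = 2)//; field.
    rewrite exprVn ler_pdivlMr ?exprn_gt0// mulrC; apply: le_trans h1.
    by rewrite ler_wpM2r ?sqr_ge0.
  rewrite -ler_sqr ?nnegrE ?mulr_ge0 ?exprn_ge0 ?addr_ge0//.
  rewrite real_normK ?num_real//; apply: le_trans le1 _.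
  rewrite exprMn -exprM mulnC exprM; apply: ler_pM; rewrite ?exprn_ge0//.
    by nra.
  by rewrite lerXn2r ?nnegrE//; lra.
exists (`|u 0%N| + 4 * (B + 1)) => n.
(* The 4 is the sum of the geometric series of ratio 3/4; the subtracted power is its remainder. *)
have : `|u n| <= `|u 0%N| + 4 * (B + 1) * (1 - (3 / 4) ^+ n).
  elim: n => [|n IH]; first by rewrite expr0 subrr mulr0 addr0.
  rewrite (_ : u n.+1 = (u n.+1 - u n) + u n); last by rewrite subrK.
  apply: le_trans (ler_normD _ _) _; have := step n; rewrite exprS.
  move: (_ ^+ n) IH => y; nra.
have : 0 <= (3 / 4) ^+ n :> R by rewrite exprn_ge0//; lra.
move: (_ ^+ n) => y; nra.
Qed.

(** Since [lam 0 = 0], the relation at k = 0 says that [g] has mean 0. This bounds [u], and bounded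
    functions lie in the form domain. *)
Lemma spectral_generatorP u g : sqsum m u -> sqsum m g ->
  (forall k, coord m eigenpoly g k = - lam k * coord m eigenpoly u k)
  <-> dirichlet_laplacian chain u g.
Proof.
move=> cu cg; split=> [E|[du _ E] k]; last first.
  by rewrite E coord_laplacian// -E.
have gL := spectral_laplacian cu cg E.
split=> //; last exact/l2P.
have [|C uC] := domain_bounded cu cg gL; last exact: bounded_form_domain uC.
have := E 0%N; rewrite lam0 oppr0 mul0r => <-; rewrite ipC; congr (ip _ _ _).
by apply/funext => n; rewrite eigenpoly0.
Qed.

Definition chain_heat := heat m nu eigenpoly lam.

Let cp := sqsum_eigenpoly.
Let pp := eigenpoly_ip.
Let pt := eigenpoly_total.
Let l0 := lam_ge0.

Lemma chain_heat_semigroup : is_heat_semigroup chain chain_heat.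
Proof.
have sh := sqsum_heat m_gt0 nu_gt0 cp pp l0.
split.
- by move=> t f t0 /l2P cf; apply/l2P; exact: sh.
- by move=> t a f g t0 /l2P cf /l2P cg; exact: (heatZD m_gt0 nu_gt0 cp pp l0).
- move=> t t0; exists 1 => f /l2P cf; rewrite mul1e !l2norm2E//; last exact: sh.
  by rewrite lee_fin; exact: (heat_contraction m_gt0 nu_gt0 cp pp pt l0).
- by move=> f /l2P cf; exact: (heat0 m_gt0 nu_gt0 cp pp pt).
- by move=> s t f s0 t0 /l2P cf; exact: (heatD m_gt0 nu_gt0 cp pp l0).
- move=> f /l2P cf.
  have /cvg0_EFin := heat_right_continuous m_gt0 nu_gt0 cp pp pt l0 cf.
  apply: cvg_trans; apply: near_eq_cvg; near=> t.
  have t0 : 0 < t by near: t; exact: nbhs_right_gt.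
  by rewrite l2norm2E//; apply: sqsumB => //; apply: sh => //; exact: ltW.
- move=> u g /l2P cu /l2P cg.
  rewrite -spectral_generatorP// -(heat_generatorP m_gt0 nu_gt0 cp pp pt l0)//.
  rewrite cvg0_EFin.
  have E : {near (0 : R)^'+,
     (fun t => l2norm2 chain (fun x => t^-1 * (chain_heat t u x - u x) - g x))
     =1 (fun t => (ip m (fun x => t^-1 * (chain_heat t u x - u x) - g x)
        (fun x => t^-1 * (chain_heat t u x - u x) - g x))%:E)}.
    near=> t; have t0 : 0 < t by near: t; exact: nbhs_right_gt.
    rewrite l2norm2E//; apply: sqsumB => //; apply: sqsumZ => //; apply: sqsumB => //.
    by apply: sh => //; exact: ltW.
  split; apply: cvg_trans; apply: near_eq_cvg; apply: filterS E => t //.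
Unshelve. all: by end_near. Qed.

(** * Evolution of [xi] and failure of the Feller property *)

Lemma xi_eigenpoly n : xi n = - (7 / 8) * eigenpoly 1 n + 7 / 8 * eigenpoly 0 n.
Proof.
(* [pcoef 1 1] is -8/7, so [eigenpoly 1] is 1 - 8/7 xi; by orthogonality 7/8 is the mean of [xi]. *)
rewrite eigenpoly0 /eigenpoly big_nat_recr//= big_nat1 /= lam0 /lam /low expr0 !expr1.
by field.
Qed.

Lemma chain_heat_xi t n : 0 <= t ->
  chain_heat t xi n = 7 / 8 * (1 - expR (- (t * lam 1))) + expR (- (t * lam 1)) * xi n.
Proof.
move=> t0.
have ce k (a : R) : sqsum m (fun n => a * eigenpoly k n) by exact: sqsumZ.
have xE : xi = fun n => - (7 / 8) * eigenpoly 1 n + 7 / 8 * eigenpoly 0 n.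
  by apply/funext => j; exact: xi_eigenpoly.
pose e := expR (- (t * lam 1)).
rewrite (_ : chain_heat t xi = fun n => - (7 / 8) * e * eigenpoly 1 n + 7 / 8 * eigenpoly 0 n).
  by rewrite -/e xi_eigenpoly eigenpoly0; move: (eigenpoly 1 n) => p; field.
have coordE (a : R) k : coord m eigenpoly (fun n => a * eigenpoly 1 n + 7 / 8 * eigenpoly 0 n) k
   = a * (if k == 1%N then (nu k)^-1 else 0) + 7 / 8 * (if k == 0%N then (nu k)^-1 else 0).
  rewrite (coordZD m_gt0 cp)// -!pp /coord; congr (_ + _).
  by rewrite ipC (ipZl m_gt0 _ (cp _) (cp _)) ipC.
apply: (heat_coord_eq m_gt0 nu_gt0 cp pp pt) => //.
- by rewrite xE; apply: sqsumD.
- by apply: sqsumD.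
move=> k; rewrite coordE xE coordE /e.
case: k => [|[|k]] /=; first by rewrite lam0 !mulr0 oppr0 expR0 !add0r mul1r.
  by ring.
by rewrite !mulr0 addr0 mulr0.
Qed.

Lemma chain_heat_pointwise t f x : 0 <= t -> sqsum m f ->
  m x * (chain_heat t f x) ^+ 2 <= ip m f f.
Proof.
move=> t0 cf; apply: le_trans (heat_contraction m_gt0 nu_gt0 cp pp pt l0 t0 cf).
by apply: ip_term => //; exact: (sqsum_heat m_gt0 nu_gt0 cp pp l0).
Qed.

Lemma chain_heatB t f g x : 0 <= t -> sqsum m f -> sqsum m g ->
  chain_heat t (fun y => f y - g y) x = chain_heat t f x - chain_heat t g x.
Proof.
move=> t0 cf cg.
rewrite (_ : (fun y => _) = fun y => -1 * g y + f y); last by apply/funext => y; ring.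
rewrite /chain_heat (heatZD m_gt0 nu_gt0 cp pp l0)//; ring.
Qed.

(** The cutoffs of [f] compete in the supremum, and their evolutions converge at [x] because the l^2
    contraction controls point values. An inequality is enough for a lower bound at infinity and
    avoids proving that the semigroup preserves positivity. *)
Lemma chain_heat_extension_ge t f x : 0 <= t -> sqsum m f -> (forall y, 0 <= f y) ->
  chain_heat t f x <= heat_extension chain_heat t f x.
Proof.
move=> t0 cf f0; rewrite /heat_extension.
rewrite (_ : (fun y => Num.max (f y) 0) = f); last by apply/funext => y; rewrite max_l.
rewrite (_ : (fun y => Num.max (- f y) 0) = fun=> 0); last first.
  by apply/funext => y; rewrite max_r// oppr_le0.
have sq0 : sqsum m (fun=> 0) by apply: (@sqsum_finite _ _ _ 0).
have -> : heat_extension_nonneg chain_heat t (fun=> 0) x = 0.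
  rewrite /heat_extension_nonneg (_ : [set _ | _ in _] = [set 0]) ?sup1//.
  have h0 : chain_heat t (fun=> 0) x = 0.
    by have := chain_heatB x t0 sq0 sq0; under eq_fun do rewrite subrr; rewrite subrr.
  apply/seteqP; split=> y /= => [[g [_ g0] <-]|->].
    rewrite (_ : g = fun=> 0)//; apply/funext => z; apply/le_anti.
    by case/andP: (g0 z) => -> ->.
  exists (fun=> 0) => //; split; last by move=> z; rewrite lexx.
  by rewrite /finsupp (_ : [set _ | _] = set0)//; apply/seteqP; split=> z //=; rewrite eqxx.
rewrite subr0 /heat_extension_nonneg; set A := [set _ | _ in _].
have ubA : has_ubound A.
  (* The contraction bounds the square of the value at [x], and y <= 1 + y^2 avoids a square
     root. *)
  exists (1 + ip m f f / m x) => _ /= [g [_ g0] <-].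
  have cg : sqsum m g.
    apply: (sqsum_dom (C := 1) m_gt0 _ cf) => y; case/andP: (g0 y) => h1 h2.
    by rewrite mul1r !ger0_norm.
  have : m x * (chain_heat t g x) ^+ 2 <= ip m f f.
    apply: le_trans (chain_heat_pointwise x t0 cg) _.
    apply: lim_series_le; [exact: ip_cvg|exact: ip_cvg|move=> y].
    case/andP: (g0 y) => h1 h2.
    by rewrite /ipt ler_wpM2l ?(ltW (m_gt0 _))// ler_pM.
  rewrite mulrC -ler_pdivlMr//; nra.
have lim : ip m (fun n => f n - cutoff N f n) (fun n => f n - cutoff N f n) / m x
    @[N --> \oo] --> (0 : R).
  by rewrite -[X in _ --> X](mul0r (m x)^-1); apply: cvgMl; exact: cvg_cutoff.
apply/ler_addgt0Pr => e e0.
have [N _ /(_ N (leqnn N))] := cvgr0_norm_le _ lim _ (exprn_gt0 2 e0).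
have cN := sqsum_cutoff m N f.
have cd := sqsumB m_gt0 cf cN.
move=> /(le_trans (ler_norm _)); rewrite ler_pdivrMr// => h.
have := le_trans (chain_heat_pointwise x t0 cd) h.
rewrite mulrC ler_pM2r// chain_heatB// => le2.
have : chain_heat t f x - chain_heat t (cutoff N f) x <= e.
  by rewrite leNgt; apply/negP; move: (_ - _) le2 => y; nra.
have : chain_heat t (cutoff N f) x <= sup A.
  apply: ub_le_sup => //; exists (cutoff N f) => //; split; first exact: finsupp_cutoff.
  by move=> y; rewrite /cutoff; case: ifP => _; rewrite ?f0 ?lexx.
lra.
Qed.

Lemma C0_xi : C0 xi.
Proof.
move=> e e0; have [N _ HN] := cvgr0_norm_le _ xi_cvg0 _ e0.
exists (cutoff N xi); first exact: finsupp_cutoff.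
move=> n; rewrite /cutoff; case: ltnP => nN; first by rewrite subrr normr0 ltW.
by rewrite subr0; exact: HN.
Qed.

(* [xi] vanishes at infinity but its evolution, an explicit combination of the
   first two eigenfunctions, is bounded below by a positive constant. *)
Lemma chain_not_feller : ~ feller chain.
Proof.
move=> /(_ _ chain_heat_semigroup 1 xi ler01 C0_xi) cE.
pose c : R := 7 / 8 * (1 - expR (- (1 * lam 1))).
have c0 : 0 < c.
  rewrite mulr_gt0// subr_gt0 expR_lt1 mul1r oppr_lt0.
  by rewrite -lam0 lam_lt.
have [|phi fphi bd] := cE (c / 2); first by rewrite divr_gt0.
have [M phi0] := finite_set_nat_bound fphi.
have phiM : phi M = 0 by apply: contrapT => /eqP /phi0; rewrite ltnn.
have := bd M; rewrite phiM subr0 => /(le_trans (ler_norm _)).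
have sx : sqsum m xi.
  by have := sqsum_xi 1; under eq_fun do rewrite expr1.
have x0 y : 0 <= xi y by exact/ltW/xi_gt0.
have := chain_heat_extension_ge M ler01 sx x0; rewrite chain_heat_xi// -/c.
have : 0 <= expR (- (1 * lam 1)) * xi M by rewrite mulr_ge0// expR_ge0.
lra.
Qed.

End Chain.

Theorem corollary5p7 (R : realType) :
  exists (K D : R) (V : choiceType) (G : weighted_graph R V),
    [/\ 0 < K, 0 < D, CD G K D, ~ feller G & ~ complete_graph G].
Proof.
exists 1, 16, nat, chain; split=> //; [exact: chain_CD|exact: chain_not_feller|].
exact: chain_incomplete.
Qed.
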